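(* Let $G$ be a group with a proper cocompact action on a CAT(0) cube complex $X$, equipped with the coarse median structure induced by this action. If $\varphi\in\mathrm{Aut}\,G$ is coarse-median preserving, then: \begin{enumerate} \item $\mathrm{Fix}\,\varphi=\{g\in G\mid\varphi(g)=g\}$ is finitely generated and undistorted in $G$; \item $\mathrm{Fix}\,\varphi$ itself admits a proper cocompact action on a CAT(0) cube complex. \end{enumerate}
   Context: Actions on cube complexes are by cubical automorphisms. The vertex set of a CAT(0) cube complex $X$, with the combinatorial metric $d$ of the $1$-skeleton, carries a median operator $m$: $m(x,y,z)$ is the unique vertex lying on a combinatorial geodesic between each two of $x,y,z$. If $G\curvearrowright X$ is proper and cocompact, the induced coarse median structure on $G$ is represented by any map $\mu_X\colon G^3\to G$ such that, for a fixed base vertex $p\in X$, the distance $d\big(\mu_X(g_1,g_2,g_3)p,\ m(g_1p,g_2p,g_3p)\big)$ is uniformly bounded (up to bounded distance in a word metric, $\mu_X$ does not depend on the choices). An automorphism $\varphi$ of $G$ is coarse-median preserving if there is $C\ge 0$ such that, for all $g_1,g_2,g_3\in G$, the elements $\varphi(\mu_X(g_1,g_2,g_3))$ and $\mu_X(\varphi(g_1),\varphi(g_2),\varphi(g_3))$ are at distance $\le C$ in a fixed word metric on $G$. A finitely generated subgroup is undistorted if its inclusion in $G$ is a quasi-isometric embedding with respect to word metrics. *)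

(* Defs.v *)
From HB Require Import structures.
From Stdlib Require Import Relation_Operators.
From mathcomp Require Import all_boot.
From mathcomp Require Import boolp classical_sets functions cardinality.

Set Implicit Arguments.
Unset Strict Implicit.
Unset Printing Implicit Defensive.

Local Open Scope classical_set_scope.
Local Open Scope group_scope.

Fixpoint walk (T : Type) (E : T -> T -> Prop) (n : nat) (x y : T) : Prop :=
  if n is k.+1 then exists z, E x z /\ walk E k z y else x = y.

(* The value 0 for points not joined by a walk is a dummy: this is only used for
   connected graphs. *)
Definition graph_dist (T : Type) (E : T -> T -> Prop) (x y : T) : nat :=
  if pselect (exists n, `[< walk E n x y >]) is left h then ex_minn h else 0%N.

Definition cube_vertex (n : nat) := {ffun 'I_n -> bool}.

Definition origin n : cube_vertex n := [ffun => false].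
Definition apex n : cube_vertex n := [ffun => true].
Definition unit_vertex n (i : 'I_n) : cube_vertex n := [ffun j => j == i].

(* For injective [s], [face_map s b] parametrizes the face of [0,1]^n through
   the vertex [b] in the directions [s 0, ..., s (k-1)]; the xor with [b] makes
   every parametrization of every face (reflected and permuted ones included)
   of this form. *)
Definition face_map k n (s : 'I_k -> 'I_n) (b : cube_vertex n)
    (x : cube_vertex k) : cube_vertex n :=
  [ffun i => if [pick j | s j == i] is Some j then b i (+) x j else b i].

(* Cubical complexes in the sense of Bridson and Haefliger (cubes are embedded,
   and two cubes meet in the empty set or in a common face), recorded by the
   restrictions to the vertices {0,1}^n of the characteristic maps of cubes.
   Each cube is present with all its 2^n n! parametrizations.  The dimension
   is not assumed to be bounded. *)
Record cube_complex := CubeComplex {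
  vertex :> Type;
  is_cube : forall n, (cube_vertex n -> vertex) -> Prop;
  is_cube_vertex : forall v : vertex, is_cube (fun _ : cube_vertex 0 => v);
  is_cube_inj : forall n (f : cube_vertex n -> vertex), is_cube f -> injective f;
  is_cube_face : forall k n (f : cube_vertex n -> vertex) (s : 'I_k -> 'I_n) b,
    is_cube f -> injective s -> is_cube (f \o face_map s b);
  is_cube_meet : forall m n (f : cube_vertex m -> vertex)
      (g : cube_vertex n -> vertex),
    is_cube f -> is_cube g -> (exists x y, f x = g y) ->
    exists k (s : 'I_k -> 'I_m) b (t : 'I_k -> 'I_n) c,
      [/\ injective s, injective t,
          forall z, f (face_map s b z) = g (face_map t c z) &
          forall x y, f x = g y ->
            exists z, x = face_map s b z /\ y = face_map t c z] }.

Section CubeComplex.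
Variable X : cube_complex.
Implicit Types (u v w : X) (p q : seq X).

Definition adjacent v w : Prop :=
  exists f : cube_vertex 1 -> X,
    [/\ is_cube f, f (origin 1) = v & f (apex 1) = w].

(* [a], [b], [c], [d] are the vertices of a square, in cyclic order. *)
Definition square (a b c d : X) : Prop :=
  exists f : cube_vertex 2 -> X,
    [/\ is_cube f, f (origin 2) = a, f (unit_vertex ord0) = b,
        f (apex 2) = c & f (unit_vertex ord_max) = d].

Definition vdist : X -> X -> nat := graph_dist adjacent.

Fixpoint edge_path v p : Prop :=
  if p is w :: q then adjacent v w /\ edge_path w q else True.

Inductive elementary_homotopy : seq X -> seq X -> Prop :=
| Backtrack p v w q of adjacent v w :
    elementary_homotopy (p ++ [:: v, w, v & q]) (p ++ v :: q)
| AcrossSquare p a b c d q of square a b c d :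
    elementary_homotopy (p ++ [:: a, b, c & q]) (p ++ [:: a, d, c & q]).

Definition homotopic : seq X -> seq X -> Prop :=
  clos_refl_sym_trans (seq X) elementary_homotopy.

Definition connected_complex : Prop :=
  (exists v : X, True) /\ forall v w, exists n, walk adjacent n v w.

(* Vanishing of the edge-path group of the 2-skeleton, i.e. of the fundamental
   group of the complex. *)
Definition simply_connected : Prop :=
  connected_complex /\
  forall v p, edge_path v p -> last v p = v -> homotopic (v :: p) [:: v].

(* The simplices of the link of [v] are given by the cubes with a corner at [v],
   its vertices by the edges at [v], i.e. by the neighbours of [v]. *)
Definition link_simplex v n (a : 'I_n -> X) : Prop :=
  exists f : cube_vertex n -> X,
    [/\ is_cube f, f (origin n) = v & forall i, f (unit_vertex i) = a i].

Definition flag_link v : Prop :=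
  forall n (a : 'I_n -> X), injective a ->
    (forall i, adjacent v (a i)) ->
    (forall i j, i != j ->
       link_simplex v (fun k : 'I_2 => if k == ord0 then a i else a j)) ->
    link_simplex v a.

(* By the intersection axiom of [cube_complex], links are simplicial complexes;
   nonpositive curvature is thus Gromov's condition that they be flag. *)
Definition cat0 : Prop := simply_connected /\ forall v, flag_link v.

Definition on_geodesic v w u : Prop :=
  exists i j, [/\ walk adjacent i v u, walk adjacent j u w &
                  (i + j)%N = vdist v w].

Definition is_median x y z (m : X) : Prop :=
  [/\ on_geodesic x y m, on_geodesic y z m & on_geodesic x z m].

(* The value [x] when there is no median is a dummy, never used if [cat0]. *)
Definition median (x y z : X) : X :=
  if pselect (exists m, is_median x y z m) is left h then projT1 (cid h) else x.

End CubeComplex.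

Record cubical_action (G : groupType) (X : cube_complex) := CubicalAction {
  act :> G -> X -> X;
  act1 : forall v, act 1 v = v;
  actM : forall g h v, act (g * h) v = act g (act h v);
  act_cube : forall g n (f : cube_vertex n -> X),
    is_cube f -> is_cube (act g \o f) }.

Section Action.
Variables (G : groupType) (X : cube_complex) (a : cubical_action G X).

(* Proper discontinuity: for finite subcomplexes [K] (every compact set lies in
   one), [K] and [g K] meet if and only if they share a vertex. *)
Definition proper_action : Prop :=
  forall K : set X, finite_set K ->
    finite_set [set g | exists2 v, K v & K (a g v)].

(* The translates of some finite subcomplex, the one spanned by [K], cover. *)
Definition cocompact_action : Prop :=
  exists2 K : set X, finite_set K &
    forall n (f : cube_vertex n -> X), is_cube f ->
      exists g, forall x, K (a g (f x)).

Definition represents_coarse_median (p : X) (mu : G -> G -> G -> G) : Prop :=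
  exists C : nat, forall g1 g2 g3,
    (vdist (a (mu g1 g2 g3) p) (median (a g1 p) (a g2 p) (a g3 p)) <= C)%N.

End Action.

Section WordMetric.
Variable G : groupType.

Definition cayley_edge (S : set G) (g h : G) : Prop :=
  exists2 s, S s & h = g * s \/ h = g * s^-1.

Definition generates (S : set G) : Prop :=
  forall g, exists n, walk (cayley_edge S) n 1 g.

Definition finite_generating (S : set G) : Prop := finite_set S /\ generates S.

Definition finitely_generated : Prop := exists S, finite_generating S.

Definition word_dist (S : set G) : G -> G -> nat := graph_dist (cayley_edge S).

Definition coarse_median_preserving (mu : G -> G -> G -> G) (S : set G)
    (phi : G -> G) : Prop :=
  exists C : nat, forall g1 g2 g3,
    (word_dist S (phi (mu g1 g2 g3)) (mu (phi g1) (phi g2) (phi g3)) <= C)%N.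

End WordMetric.

(* Natural number constants lose no generality; the usual lower bound
   d(x,y)/L - A <= d'(f x, f y) is multiplied out. *)
Definition qi_embedding (A B : Type) (dA : A -> A -> nat) (dB : B -> B -> nat)
    (f : A -> B) : Prop :=
  exists L K : nat, forall x y,
    (dB (f x) (f y) <= L * dA x y + K)%N /\
    (dA x y <= L * dB (f x) (f y) + K)%N.

(* [i] is the inclusion of the subgroup [H]. *)
Definition undistorted (H G : groupType) (i : H -> G) : Prop :=
  forall (T : set H) (S : set G),
    finite_generating T -> finite_generating S ->
    qi_embedding (word_dist T) (word_dist S) i.

Section FixedSubgroup.
Variables (G : groupType) (phi : {multiplicative G -> G}).

Definition fixed_pred : pred G := fun g => phi g == g.

Fact fixed_pred_closed : group_closed fixed_pred.
Proof.
have phi1 : phi 1 = 1.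
  by apply: (mulgI (phi 1)); rewrite -gmulfM !mulg1.
split=> [|g h /eqP gE /eqP hE]; rewrite unfold_in /fixed_pred; first exact/eqP.
apply/eqP; rewrite gmulfM gE; congr (_ * _).
by apply: (mulgI h); rewrite -{1}hE -gmulfM !mulgV.
Qed.

Record Fix := MkFix { fix_val :> G; fix_valP : fixed_pred fix_val }.

HB.instance Definition _ := [isSub for fix_val].
HB.instance Definition _ := [Choice of Fix by <:].
HB.instance Definition _ :=
  SubChoice_isSubGroup.Build G fixed_pred Fix fixed_pred_closed.

End FixedSubgroup.

(* Main.v *)
Require Import Defs.
From HB Require Import structures.
From Stdlib Require Import Relation_Operators.
From mathcomp Require Import all_boot zify.
From mathcomp Require Import boolp classical_sets functions cardinality.

(** Why this is true. Let [H] be the fixed subgroup and [p] a vertex of [X].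

    If [g1], [g2], [g3] are fixed by [phi], then [phi] moves [mu g1 g2 g3] by a
    bounded amount, and hence by an element of a finite set. Two elements that are
    moved by the same element differ by an element of [H], so that [mu g1 g2 g3] is
    at bounded distance from [H]. In other words the orbit of [p] under [H] is an
    approximate median subalgebra of [X] ([fix_orbit_approximate]).

    Let [M] be the median subalgebra generated by this orbit. Every point of [M] is
    obtained from the orbit by a number of iterated medians that is bounded by the
    degree of [X]: a point [x] is the only one in all the halfspaces given by the
    edges at [x]; any two of these halfspaces have a common point in the orbit, as
    otherwise the complement of their intersection would be a subalgebra containing
    the orbit but not [x]; and each further halfspace costs one more median
    ([generated_iterated_medians]). As the median is Lipschitz, [M] is at bounded
    distance from the orbit ([generated_near]).

    Now [M] is a discrete median algebra, and thus the set of vertices of a CAT(0)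
    cube complex ([median_complex_cat0]), on which [H] acts properly. Different
    edges of this complex at a vertex [v] start with different edges of [X], so that
    the degree is bounded; with the previous paragraph this shows that there are
    finitely many orbits of edges and of cubes. The action is therefore cocompact
    ([hull_cocompact]), [H] is generated by the elements that move [p] by at most
    some constant, and, as edges of [M] have positive length in [X] and these
    lengths add up along geodesics, word lengths in [H] are at most linear in
    distances in [X] ([orbit_generating]). Hence [H] is undistorted.

    All this rests on the median structure of [X], which has to be derived from
    simple connectivity and the flag condition. Call two edge paths equivalent if
    they differ by pushing them across squares. By flagness, equivalent paths with
    different last edges share, up to equivalence, everything but two sides of a
    square ([exchange]). It follows that edges act on equivalence classes of paths
    that cannot be made to backtrack, by appending or cancelling, in a way that is
    compatible with homotopies ([extendK], [extend_square]). By simple connectivity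
    there is one such class for any two end points, which thus consists of all the
    geodesics; this yields the quadrangle condition ([quadrangle_condition]): two
    neighbours of [u] that are closer to [o] than [u] lie in a square with [u] and a
    vertex that is still closer. The remaining theory of halfspaces ([side_crossing],
    [side_convex]) and medians ([exists_median], [side_median]) follows from this
    condition and from the graph being bipartite. *)

Set Implicit Arguments.
Unset Strict Implicit.
Unset Printing Implicit Defensive.

(** * Edges and squares of a cube complex *)

Lemma face_map_in k n (s : 'I_k -> 'I_n) b x i :
  injective s -> face_map s b x (s i) = b (s i) (+) x i.
Proof.
move=> s_inj; rewrite ffunE; case: pickP => [j /eqP /s_inj -> //|/(_ i)].
by rewrite eqxx.
Qed.

Lemma face_map_out k n (s : 'I_k -> 'I_n) b x l :
  (forall i, s i != l) -> face_map s b x l = b l.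
Proof.
move=> out; rewrite ffunE; case: pickP => // j /eqP sj.
by move: (out j); rewrite sj eqxx.
Qed.

Definition flip n (b : cube_vertex n) (i : 'I_n) : cube_vertex n :=
  [ffun k => b k (+) (k == i)].

Lemma flip_origin n (i : 'I_n) : flip (origin n) i = unit_vertex i.
Proof. by apply/ffunP => k; rewrite !ffunE. Qed.

Definition pair_fun n (i j : 'I_n) (k : 'I_2) : 'I_n := if k == ord0 then i else j.

Lemma ord2P (k : 'I_2) : k = ord0 \/ k = ord_max.
Proof. by case: k => -[|[|k]] // ?; [left|right]; apply/val_inj. Qed.

Lemma pair_fun_inj n (i j : 'I_n) : i != j -> injective (pair_fun i j).
Proof.
move=> /eqP ij k l; case: (ord2P k) => ->; case: (ord2P l) => -> // e;
by case: ij; (exact: e || exact: esym e).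
Qed.

Lemma cube_vertex2P (x y : cube_vertex 2) :
  x ord0 = y ord0 -> x ord_max = y ord_max -> x = y.
Proof. by move=> x0 x1; apply/ffunP => k; case: (ord2P k) => ->. Qed.

Lemma cube_vertex1P (x y : cube_vertex 1) : x ord0 = y ord0 -> x = y.
Proof. by move=> x0; apply/ffunP => k; rewrite ord1. Qed.

Lemma face_pair n (i j : 'I_n) b x : i != j ->
  face_map (pair_fun i j) b x =
  [ffun k => b k (+) (((k == i) && x ord0) || ((k == j) && x ord_max))].
Proof.
move=> ij; have inj := pair_fun_inj ij; apply/ffunP => k.
rewrite [RHS]ffunE.
have [->|ki] := eqVneq k i.
  by have := @face_map_in _ _ _ b x ord0 inj; rewrite /pair_fun /= => ->;
     rewrite (negPf ij) orbF.
have [->|kj] := eqVneq k j.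
  by have := @face_map_in _ _ _ b x ord_max inj; rewrite /pair_fun /= => ->.
rewrite face_map_out ?addbF // => l; rewrite /pair_fun.
by case: ifP => _; rewrite eq_sym.
Qed.

Section Squares.
Variable X : cube_complex.
Implicit Types a b c d o : X.

Lemma cube_square n (f : cube_vertex n -> X) (b : cube_vertex n) i j :
  is_cube f -> i != j ->
  square (f b) (f (flip b i)) (f (flip (flip b i) j)) (f (flip b j)).
Proof.
move=> fcube ij; exists (f \o face_map (pair_fun i j) b); split.
- by apply: is_cube_face => //; apply: pair_fun_inj.
- by rewrite /= face_pair //; congr f; apply/ffunP => k; rewrite !ffunE !andbF addbF.
- rewrite /= face_pair //; congr f; apply/ffunP => k.
  by rewrite !ffunE /= andbT andbF orbF.
- rewrite /= face_pair //; congr f; apply/ffunP => k.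
  rewrite !ffunE !andbT -addbA; congr addb.
  by have [->|//] := eqVneq k i; rewrite (negPf ij).
- rewrite /= face_pair //; congr f; apply/ffunP => k.
  by rewrite !ffunE /= andbT andbF.
Qed.

Lemma cube_edge n (f : cube_vertex n -> X) (b : cube_vertex n) i :
  is_cube f -> adjacent (f b) (f (flip b i)).
Proof.
move=> fcube.
have inj : injective (fun _ : 'I_1 => i) by move=> k l _; rewrite !ord1.
exists (f \o face_map (fun _ : 'I_1 => i) b); split.
- exact: is_cube_face.
- rewrite /=; congr f; apply/ffunP => k.
  have [->|ki] := eqVneq k i.
    by rewrite (@face_map_in _ _ _ b _ ord0) // !ffunE addbF.
  by rewrite face_map_out // => l; rewrite eq_sym.
- rewrite /=; congr f; apply/ffunP => k.
  have [->|ki] := eqVneq k i.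
    by rewrite (@face_map_in _ _ _ b _ ord0) // !ffunE eqxx.
  by rewrite face_map_out ?ffunE ?(negPf ki) ?addbF // => l; rewrite eq_sym.
Qed.

Lemma adjacent_sym a b : adjacent a b -> adjacent b a.
Proof.
case=> f [fcube <- <-]; have -> : origin 1 = flip (apex 1) ord0.
  by apply/ffunP => k; rewrite !ffunE ord1.
exact: cube_edge.
Qed.

Lemma adjacent_neq a b : adjacent a b -> a <> b.
Proof.
case=> f [/is_cube_inj f_inj <- <-] /f_inj /ffunP /(_ ord0).
by rewrite !ffunE.
Qed.

Lemma square_swap a b c d : square a b c d -> square a d c b.
Proof.
case=> f [fcube <- <- <- <-].
have := cube_square (origin 2) (i := ord_max) (j := ord0) fcube isT.
rewrite !flip_origin; set u := flip _ _; suff -> : u = apex 2 by [].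
by apply: cube_vertex2P; rewrite !ffunE.
Qed.

Lemma square_rot a b c d : square a b c d -> square b c d a.
Proof.
case=> f [fcube <- <- <- <-].
have := cube_square (unit_vertex ord0) (i := ord_max) (j := ord0) fcube isT.
have -> : flip (unit_vertex (ord0 : 'I_2)) ord_max = apex 2.
  by apply: cube_vertex2P; rewrite !ffunE.
have -> : flip (apex 2) ord0 = unit_vertex ord_max.
  by apply: cube_vertex2P; rewrite !ffunE.
have -> // : flip (unit_vertex (ord0 : 'I_2)) ord0 = origin 2.
by apply: cube_vertex2P; rewrite !ffunE.
Qed.

Lemma square_flip a b c d : square a b c d -> square c b a d.
Proof. by move=> /square_rot /square_rot /square_swap. Qed.

Lemma square_adj a b c d : square a b c d -> adjacent a b.
Proof.
case=> f [fcube <- <- _ _]; rewrite -flip_origin; exact: cube_edge.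
Qed.

Lemma square_diag a b c d : square a b c d -> a <> c.
Proof.
case=> f [/is_cube_inj f_inj <- _ <- _] /f_inj /ffunP /(_ ord0).
by rewrite !ffunE.
Qed.

(** The common face of two squares sharing three vertices is two-dimensional,
    hence both of them. *)
Lemma square_uniq a b c d d' : square a b c d -> square a b c d' -> d = d'.
Proof.
case=> f [fcube fa fb fc fd] [g [gcube ga gb gc gd]].
have f_inj := is_cube_inj fcube; have g_inj := is_cube_inj gcube.
have [|k [s [x0 [t [y0 [s_inj t_inj fg meet]]]]]] := is_cube_meet fcube gcube.
  by exists (origin 2), (origin 2); rewrite fa ga.
have [z0 [ez0 _]] := meet (origin 2) (origin 2) (etrans fa (esym ga)).
have [z1 [ez1 _]] := meet _ _ (etrans fb (esym gb)).
have [z2 [ez2 _]] := meet _ _ (etrans fc (esym gc)).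
have s_onto i : exists j, s j = i.
  apply: contrapT => no; have out j : s j != i.
    by apply/eqP => sj; apply: no; exists j.
  have x0E u z : u = face_map s x0 z -> x0 i = u i.
    by move=> ->; rewrite face_map_out.
  have := x0E _ _ ez0; rewrite (x0E _ _ ez2) => /eqP.
  by rewrite !ffunE.
pose z : cube_vertex k := [ffun j => unit_vertex ord_max (s j) (+) x0 (s j)].
have ez : face_map s x0 z = unit_vertex ord_max.
  apply/ffunP => i; have [j <-] := s_onto i.
  by rewrite face_map_in // ffunE addbC -addbA addbb addbF.
have fgz := fg z; rewrite ez fd in fgz.
rewrite fgz -gd; congr g.
move: (face_map t y0 z) fgz => y fgz.
have neq (u v : cube_vertex 2) (w : X) : f u = w -> g v = w -> u != unit_vertex ord_max -> y != v.
  move=> fu gv uz; apply/eqP => yv; move/eqP: uz; apply; apply: f_inj.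
  by rewrite fu -gv -yv -fgz fd.
have := neq _ _ _ fa ga; have := neq _ _ _ fb gb; have := neq _ _ _ fc gc.
have ne (u v : cube_vertex 2) i : u i != v i -> u != v.
  by apply: contra_neq => ->.
move=> /(_ (ne _ _ ord0 _)); rewrite !ffunE => /(_ isT) /eqP y1.
move=> /(_ (ne _ _ ord0 _)); rewrite !ffunE => /(_ isT) /eqP y2.
move=> /(_ (ne _ _ ord_max _)); rewrite !ffunE => /(_ isT) /eqP y3.
case y00 : (y ord0); case y11 : (y ord_max).
- by case: y1; apply: cube_vertex2P; rewrite !ffunE.
- by case: y2; apply: cube_vertex2P; rewrite !ffunE.
- by apply: cube_vertex2P; rewrite !ffunE.
- by case: y3; apply: cube_vertex2P; rewrite !ffunE.
Qed.

Lemma square_link a b c d : square a b c d ->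
  link_simplex a (fun k : 'I_2 => if k == ord0 then b else d).
Proof.
case=> f [fcube fa fb _ fd]; exists f; split=> // i.
by case: (ord2P i) => ->.
Qed.

(** The flag condition fills the corner formed by the three squares with a 3-cube.
    By [square_uniq] the faces of this cube at [o] are the given squares; the other
    three faces meet at the vertex [q] opposite to [o]. *)
Lemma cube_completion o a b c ab bc ac :
    flag_link o -> square o a ab b -> square o b bc c -> square o a ac c ->
    a <> b -> b <> c -> a <> c ->
  exists q, [/\ square a ab q ac, square b ab q bc & square c ac q bc].
Proof.
move=> flag sab sbc sac nab nbc nac.
pose n3 : 'I_3 -> X := fun i => tnth [tuple a; b; c] i.
pose i0 : 'I_3 := inord 0; pose i1 : 'I_3 := inord 1; pose i2 : 'I_3 := inord 2.
have v0 : (i0 : nat) = 0 by rewrite inordK.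
have v1 : (i1 : nat) = 1 by rewrite inordK.
have v2 : (i2 : nat) = 2 by rewrite inordK.
have ord3 (i : 'I_3) : [\/ i = i0, i = i1 | i = i2].
  by case: i => -[|[|[|i]]] // hi; [constructor 1|constructor 2|constructor 3];
     apply/val_inj; rewrite /= ?v0 ?v1 ?v2.
have n0 : n3 i0 = a by rewrite /n3 (tnth_nth a) v0.
have n1 : n3 i1 = b by rewrite /n3 (tnth_nth a) v1.
have n2 : n3 i2 = c by rewrite /n3 (tnth_nth a) v2.
have i01 : i0 != i1 by rewrite -val_eqE /= v0 v1.
have i12 : i1 != i2 by rewrite -val_eqE /= v1 v2.
have i02 : i0 != i2 by rewrite -val_eqE /= v0 v2.
have [||i j|f [fcube fo fn]] := flag 3 n3.
- move=> i j; case: (ord3 i) => ->; case: (ord3 j) => -> //; rewrite ?n0 ?n1 ?n2 => e;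
  by exfalso; congruence.
- move=> i; case: (ord3 i) => ->; rewrite ?n0 ?n1 ?n2.
  + exact: square_adj sab.
  + exact: square_adj sbc.
  + exact: square_adj (square_swap sac).
- case: (ord3 i) => ->; case: (ord3 j) => ->; rewrite ?eqxx // ?n0 ?n1 ?n2 => _;
  apply: square_link; (exact: sab || exact: sbc || exact: sac ||
    exact: (square_swap sab) || exact: (square_swap sbc) || exact: (square_swap sac)).
have fl (x : cube_vertex 3) i j : flip (flip x i) j = flip (flip x j) i.
  by apply/ffunP => k; rewrite !ffunE -!addbA (addbC (k == i)).
pose e := origin 3.
have fe0 : f (flip e i0) = a by rewrite flip_origin fn n0.
have fe1 : f (flip e i1) = b by rewrite flip_origin fn n1.
have fe2 : f (flip e i2) = c by rewrite flip_origin fn n2.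
have top i j u v w : i != j -> f (flip e i) = u -> f (flip e j) = v ->
    square o u w v -> f (flip (flip e i) j) = w.
  move=> ij fi fj sq; have := cube_square e fcube ij.
  rewrite fo fi fj => /square_rot/square_rot/square_rot sq'.
  exact: square_uniq sq' (square_rot (square_rot (square_rot sq))).
have f01 := top _ _ _ _ _ i01 fe0 fe1 sab.
have f12 := top _ _ _ _ _ i12 fe1 fe2 sbc.
have f02 := top _ _ _ _ _ i02 fe0 fe2 sac.
exists (f (flip (flip (flip e i0) i1) i2)); split.
- by have := cube_square (flip e i0) fcube i12; rewrite fe0 f01 f02.
- have := cube_square (flip e i1) fcube i02.
  by rewrite fe1 (fl e i1 i0) f01 f12.
- have := cube_square (flip e i2) fcube i01.
  by rewrite fe2 (fl e i2 i0) (fl e i2 i1) (fl (flip e i0) i2 i1) f02 f12.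
Qed.

End Squares.

(** * Square moves and normal forms of edge paths *)

Section Moves.
Variable X : cube_complex.
Hypothesis flag : forall v : X, flag_link v.
Implicit Types (u v w x y : X) (p q r s : seq X).

(** In this part paths are written backwards, with their last vertex at the
    head of the list, since they are extended at that end. *)
Inductive move : seq X -> seq X -> Prop :=
| move_head a b c d q : square a b c d -> move [:: c, b, a & q] [:: c, d, a & q]
| move_tail x p q : move p q -> move (x :: p) (x :: q).

Inductive moves : seq X -> seq X -> Prop :=
| moves_refl p : moves p p
| moves_step p q r : move p q -> moves q r -> moves p r.

Lemma move_sym p q : move p q -> move q p.
Proof.
by elim=> [a b c d {}q /square_swap sq|x {}p {}q _]; [apply: move_head|apply: move_tail].
Qed.

Lemma moves_trans q p r : moves p q -> moves q r -> moves p r.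
Proof.
by move=> pq; elim: pq r => // {}p {}q s pq _ IH r /IH; apply: moves_step.
Qed.

Lemma moves1 p q : move p q -> moves p q.
Proof. by move=> pq; apply: moves_step pq (moves_refl _). Qed.

Lemma moves_sym p q : moves p q -> moves q p.
Proof.
elim=> [r|{}p {}q r /move_sym/moves1 qp _ rq]; [exact: moves_refl|].
exact: moves_trans rq qp.
Qed.

Lemma moves_cons x p q : moves p q -> moves (x :: p) (x :: q).
Proof.
elim=> [r|{}p {}q r pq _ IH]; first exact: moves_refl.
by apply: moves_step IH; apply: move_tail.
Qed.

Lemma moves_square a b c d q : square a b c d ->
  moves [:: c, b, a & q] [:: c, d, a & q].
Proof. by move=> /move_head sq; apply: moves1. Qed.

Lemma move_headE x p q : move (x :: p) q -> exists q', q = x :: q'.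
Proof.
move E : (x :: p) => l m; case: m E => [a b c d r sq [-> _]|y l' r _ [-> _]]; by eexists.
Qed.

Lemma moves_headE x p q : moves (x :: p) q -> exists q', q = x :: q'.
Proof.
move E : (x :: p) => l m; elim: m p E => [_ p <-|p' q' r pq _ IH p E]; first by eexists.
by rewrite -E in pq; have [p'' e] := move_headE pq; apply: (IH p'').
Qed.

Lemma moves_size p q : moves p q -> size p = size q.
Proof.
elim=> // {}p {}q r pq _ <-; elim: pq => //= x p' q' _ -> //.
Qed.

Lemma moves_last x p q : moves p q -> last x p = last x q.
Proof.
elim=> // {}p {}q r pq _ <-; elim: pq x => //= x y p' q' _ -> //.
Qed.

(** Two ways of reaching [v]: up to moves, the paths either agree before [v], or
    differ by a single square at [v]. *)
Definition exchangeable v p q :=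
  moves p q \/ exists w1 w2 x s,
    [/\ moves p [:: w1, x & s], moves q [:: w2, x & s] & square v w1 x w2].

(** The heart of the matter, and the only use of nonpositive curvature. Suppose that
    [p] and [q] differ by a square at [v], and so do [q] and [r]. Both squares
    contain the last vertex [w2] of [q]; the induction hypothesis, applied to the two
    forms of [q], gives a third square at [w2] unless the first two are equal. The
    cube that the three squares span has another face at [v], which relates [p]
    and [r]. *)
Lemma exchangeable_trans v p q r :
    (forall w s t, size (w :: s) <= size p -> moves (w :: s) (w :: t) ->
       exchangeable w s t) ->
  exchangeable v p q -> exchangeable v q r -> exchangeable v p r.
Proof.
move=> IH [pq|[w1 [w2 [x [s [pw qw sq]]]]]] [qr|[w2' [w3 [x' [s' [qw' rw sq']]]]]].
- by left; apply: moves_trans qr.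
- right; exists w2', w3, x', s'; split=> //; exact: moves_trans qw'.
- right; exists w1, w2, x, s; split=> //; exact: moves_trans (moves_sym qr) qw.
have m := moves_trans (moves_sym qw) qw'.
have [_ [e _]] := moves_headE m; rewrite {}e in rw sq' m qw'.
have sz : size [:: w2, x & s] <= size p by rewrite (moves_size pw).
have [e|[x1 [x2 [y [t [xs xs' sqy]]]]]] := IH _ _ _ sz m.
  have [_ [e' _]] := moves_headE e; rewrite {}e' in rw sq' e m qw'.
  left; have e1 : w1 = w3.
    exact: square_uniq (square_swap sq) sq'.
  apply: moves_trans pw _; apply: moves_trans (moves_sym rw).
  by rewrite e1; apply: moves_cons.
have [_ [e1 _]] := moves_headE xs; have [_ [e2 _]] := moves_headE xs'.
rewrite {}e1 {}e2 in xs xs' sqy *.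
have [|||o [sq1 sq2 sq3]] := cube_completion (@flag w2)
   (square_rot (square_rot (square_rot sq))) sqy
   (square_rot (square_rot (square_rot (square_swap sq')))).
- exact: square_diag sq.
- exact: square_diag (square_rot sqy).
- exact: square_diag sq'.
right; exists w1, w3, o, (y :: t); split=> //.
- apply: moves_trans pw _; apply: moves_trans (moves_cons _ xs) _.
  by apply: moves_square; exact: (square_rot (square_rot (square_rot sq2))).
- apply: moves_trans rw _; apply: moves_trans (moves_cons _ xs') _.
  by apply: moves_square; exact: (square_rot (square_rot (square_rot sq3))).
Qed.

Lemma move_exchangeable v p q : move (v :: p) (v :: q) -> exchangeable v p q.
Proof.
move Ep : (v :: p) => p'; move Eq : (v :: q) => q' m.
case: m Ep Eq => [a b c d r sq [-> ->] [->]|x l l' m [_ ->] [_ ->]].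
  by right; exists b, d, a, r; split; [left|left|exact: square_flip sq].
by left; apply: moves1.
Qed.

(** The exchange property: an analogue, for paths modulo square moves, of the one of
    reduced words in right-angled Coxeter groups. *)
Lemma exchange v p q : moves (v :: p) (v :: q) -> exchangeable v p q.
Proof.
elim/ltn_ind: {p}(size p) {-2}p (erefl (size p)) v q => n IHn p pn v q m.
move Ep : (v :: p) m => p'; move Eq : (v :: q) => q' m.
elim: m p pn Ep q Eq => [l|l1 l2 l3 m1 m IH] p pn Ep q Eq.
  by move: Ep; rewrite -Eq => -[->]; left; apply: moves_refl.
rewrite -Ep in m1; have [r e] := move_headE m1; rewrite {}e in m1 m IH.
have rp : size r = size p by have := moves_size (moves1 m1) => -[].
apply: (exchangeable_trans (q := r)).
- move=> w s t sz ms; apply: (IHn (size s)) => //; first by rewrite -pn.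
- exact: move_exchangeable.
- by apply: IH => //; rewrite rp.
Qed.

Inductive backtracks : seq X -> Prop :=
| backtracks_head x y p : backtracks [:: x, y, x & p]
| backtracks_tail x p : backtracks p -> backtracks (x :: p).

(** A local substitute for being a geodesic: the two notions turn out to agree by
    [geodesic_reduced] and [reduced_uniq], in the absence of fundamental group. *)
Definition reduced p := forall q, moves p q -> ~ backtracks q.

Lemma reduced_moves p q : moves p q -> reduced p -> reduced q.
Proof. by move=> pq red r qr; apply: red; apply: moves_trans qr. Qed.

Lemma reduced_tail x p : reduced (x :: p) -> reduced p.
Proof. by move=> red q pq bq; apply: (red (x :: q)); [exact: moves_cons|constructor]. Qed.

Lemma reduced1 x : reduced [:: x].
Proof.
move=> q m bq; have := moves_size m.
by case: bq => [//|y p []].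
Qed.

Lemma square_nodiag v w x : ~ square v w x w.
Proof. by move=> /square_rot /square_diag. Qed.

Lemma exchange_same v w p q : moves [:: v, w & p] [:: v, w & q] ->
  moves (w :: p) (w :: q).
Proof.
case/exchange=> // -[w1 [w2 [x [s [pw qw sq]]]]].
have [_ [e1 _]] := moves_headE pw; have [_ [e2 _]] := moves_headE qw.
by move: sq; rewrite e1 e2 => /square_nodiag.
Qed.

(** By induction on the length: if the path extended to [w] could be made to
    backtrack, then by exchange so could the shorter path [x :: s] extended to
    [w2], where [w], [v], [x], [w2] is a square. Hence [x :: s] can be made to come
    from [w2], and [v :: r] to come from [w] through that square. *)
Lemma reduced_cons w v r : reduced (v :: r) ->
  ~ (exists r', moves (v :: r) [:: v, w & r']) -> reduced [:: w, v & r].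
Proof.
move=> red nd q m bq; move Eq : q m bq => q0 m bq.
elim/ltn_ind: {r}(size r) {-2}r (erefl (size r)) w v red nd q q0 Eq m bq
  => n IH r rn w v red nd _ q _ m bq.
have [q' e] := moves_headE m; rewrite {}e in m bq.
case: (exchange m) => [mv|[w1 [w2 [x [s [mr mq sq]]]]]].
  have [q'' e] := moves_headE mv; rewrite {}e in m mv bq.
  move El : [:: w, v & q''] bq => l bq; case: bq El => [x y p [ew ev e]|x p bp [_ e]].
    by subst; apply: nd; exists p.
  by rewrite -e in bp; exact: (red _ mv).
have [_ [e _]] := moves_headE mr; rewrite {}e in mr sq.
have red' : reduced (x :: s).
  by apply: (@reduced_tail v); apply: reduced_moves red.
have sq3 := square_rot (square_rot (square_rot sq)).
move El : (w :: q') bq => l bq; case: bq El => [x0 y p [<- eq]|x0 p bp [_ eq]].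
  rewrite {}eq in mq; have [_ [e _]] := moves_headE mq; rewrite {}e in mq sq sq3.
  case: (exchange mq) => [wx|[a1 [a2 [o [t [ma1 ma2 sqo]]]]]].
    by have [_ [e _]] := moves_headE wx; apply: (square_diag sq); rewrite e.
  have [_ [e _]] := moves_headE ma1; rewrite {}e in ma1 sqo.
  have [_ [e _]] := moves_headE ma2; rewrite {}e in ma2 sqo.
  have e : o = v.
    apply: square_uniq (square_rot (square_rot (square_rot sqo))) _.
    exact: square_rot (square_rot (square_rot sq3)).
  rewrite e in ma2; apply: (red [:: v, x, v & t]); last exact: backtracks_head.
  by apply: moves_trans mr _; apply: moves_cons.
rewrite -eq in bp; have sz : size s < n.
  by have := moves_size mr => /= -[]; rewrite rn => ->.
apply: (IH _ sz s (erefl _) w2 x red' _ q' _ (erefl _) (moves_sym mq) bp).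
case=> r' mr'; apply: nd; exists (w2 :: r'); apply: moves_trans mr _.
apply: moves_trans (moves_cons _ mr') _; apply: moves_square.
exact: square_swap sq3.
Qed.

(** The action of edges on reduced paths modulo square moves. It respects the two
    elementary homotopies, by [extendK] and [extend_square], so that it only depends
    on homotopy classes: this is van der Waerden's argument for the uniqueness of
    normal forms, which needs no confluence of rewriting. *)
Definition extend p w : seq X :=
  if p is v :: r then
    if pselect (exists r', moves (v :: r) [:: v, w & r']) is left h
    then w :: projT1 (cid h) else [:: w, v & r]
  else [:: w].

Lemma extend_cancel v w r r' : moves (v :: r) [:: v, w & r'] ->
  moves (extend (v :: r) w) (w :: r').
Proof.
move=> m; rewrite /extend; case: pselect => [h|[]]; last by exists r'.
case: cid => /= r'' m'; apply: exchange_same; exact: moves_trans (moves_sym m') m.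
Qed.

Lemma extend_append v w r : ~ (exists r', moves (v :: r) [:: v, w & r']) ->
  extend (v :: r) w = [:: w, v & r].
Proof. by move=> nd; rewrite /extend; case: pselect. Qed.

Lemma extend_head p w : exists r, extend p w = w :: r.
Proof. by case: p => [|v r]; rewrite /extend; [|case: pselect => h]; eexists. Qed.

Lemma extend_reduced p w : reduced p -> reduced (extend p w).
Proof.
case: p => [_|v r red]; first exact: reduced1.
case: (pselect (exists r', moves (v :: r) [:: v, w & r'])) => [[r' m]|nd].
  apply: reduced_moves (moves_sym (extend_cancel m)) _.
  exact: reduced_tail (reduced_moves m red).
by rewrite extend_append //; apply: reduced_cons.
Qed.

Lemma extend_moves p q w : moves p q -> moves (extend p w) (extend q w).
Proof.
case: p => [|v r] m; first by case: q m => [_|x q /moves_size]; first exact: moves_refl.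
have [r' e] := moves_headE m; rewrite {}e in m *.
case: (pselect (exists r', moves (v :: r) [:: v, w & r'])) => [[s ms]|nd].
  apply: moves_trans (extend_cancel ms) (moves_sym (extend_cancel _)).
  exact: moves_trans (moves_sym m) ms.
rewrite !extend_append //; first exact: moves_cons.
by case=> s ms; apply: nd; exists s; apply: moves_trans ms.
Qed.

Lemma extendK v r w : reduced (v :: r) ->
  moves (extend (extend (v :: r) w) v) (v :: r).
Proof.
move=> red.
case: (pselect (exists r', moves (v :: r) [:: v, w & r'])) => [[s ms]|nd].
  apply: moves_trans (extend_moves _ (extend_cancel ms)) _.
  rewrite extend_append; first exact: moves_sym.
  case=> t mt; apply: (red [:: v, w, v & t]); last exact: backtracks_head.
  exact: moves_trans ms (moves_cons _ mt).
by rewrite extend_append //; apply: extend_cancel; apply: moves_refl.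
Qed.

(** If neither edge of the square at [a] cancels, the two ways around it differ by a
    move. If one of them cancels, then so does the edge opposite to it once the
    other one is appended. If both cancel, then by exchange the path has run through
    the square itself. *)
Lemma extend_square a b c d r : square a b c d -> reduced (a :: r) ->
  moves (extend (extend (a :: r) b) c) (extend (extend (a :: r) d) c).
Proof.
wlog nd : b d / ~ (exists r', moves (a :: r) [:: a, d & r']).
  move=> W sq red.
  have [[s ms]|nd] := pselect (exists r', moves (a :: r) [:: a, d & r']); last exact: W.
  have [[t mt]|nd] := pselect (exists r', moves (a :: r) [:: a, b & r']); last first.
    by apply: moves_sym; apply: W => //; apply: square_swap.
  apply: moves_trans (extend_moves _ (extend_cancel mt)) _.
  apply: moves_sym; apply: moves_trans (extend_moves _ (extend_cancel ms)) _.
  have m := moves_trans (moves_sym mt) ms.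
  case: (exchange m) => [m'|[b' [d' [x [u [mb md sqx]]]]]].
    by have [_ [e _]] := moves_headE m'; move: sq; rewrite e => /square_nodiag.
  have [_ [e _]] := moves_headE mb; rewrite {}e in mb sqx.
  have [_ [e _]] := moves_headE md; rewrite {}e in md sqx.
  have e : x = c.
    apply: square_uniq (square_rot (square_rot (square_rot sqx))) _.
    exact: square_rot (square_rot (square_rot sq)).
  rewrite {}e in mb md.
  exact: moves_trans (extend_cancel md) (moves_sym (extend_cancel mb)).
move=> sq red.
have [[t mt]|nb] := pselect (exists r', moves (a :: r) [:: a, b & r']).
  apply: moves_trans (extend_moves _ (extend_cancel mt)) _.
  rewrite (extend_append nd) extend_append; last first.
    case=> u mu; apply: nd; exists (c :: u); apply: moves_trans mt _.
    apply: moves_trans (moves_cons _ mu) _; apply: moves_square.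
    exact: square_flip sq.
  apply: moves_sym; apply: extend_cancel.
  apply: moves_trans (moves_cons _ mt) _; apply: moves_square.
  exact: square_rot (square_rot (square_rot (square_swap sq))).
have noc x y : ~ (exists r', moves (a :: r) [:: a, y & r']) -> square a x c y ->
    ~ exists r', moves [:: x, a & r] [:: x, c & r'].
  move=> ny sqx [u mu]; case: (exchange mu) => [m|[a' [c' [z [v [ma mc sqz]]]]]].
    by have [_ [e _]] := moves_headE m; apply: (square_diag sqx); rewrite e.
  have [_ [e _]] := moves_headE ma; rewrite {}e in ma sqz.
  have [_ [e _]] := moves_headE mc; rewrite {}e in mc sqz.
  have e : z = y.
    apply: square_uniq (square_rot (square_rot (square_rot sqz))) _.
    exact: square_flip sqx.
  by apply: ny; exists v; rewrite -e.
rewrite (extend_append nb) (extend_append nd) extend_append; last exact: (noc b d).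
rewrite extend_append; last by apply: (noc d b) => //; apply: square_swap.
by apply: moves_square.
Qed.

End Moves.

Arguments extend : simpl never.

(** * The combinatorial metric *)

Section Walks.
Variables (T : Type) (E : T -> T -> Prop).
Implicit Types x y z : T.

Lemma walk_cat m n x y z : walk E m x y -> walk E n y z -> walk E (m + n) x z.
Proof.
by elim: m x => [x ->|m IH x [u [xu uy]] yz] //=; exists u; split=> //; apply: IH.
Qed.

Lemma walk1 x y : E x y -> walk E 1 x y.
Proof. by exists y. Qed.

Lemma walk_sym (symE : forall x y, E x y -> E y x) n x y :
  walk E n x y -> walk E n y x.
Proof.
elim: n x => [x ->|n IH x [u [/symE ux /IH uy]]] //.
by rewrite -addn1; apply: walk_cat uy (walk1 ux).
Qed.

Lemma graph_dist_le n x y : walk E n x y -> graph_dist E x y <= n.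
Proof.
move=> w; rewrite /graph_dist; case: pselect => [h|[]]; last by exists n; apply/asboolP.
by case: ex_minnP => k _; apply; apply/asboolP.
Qed.

Lemma graph_dist_walk n x y : walk E n x y -> walk E (graph_dist E x y) x y.
Proof.
move=> w; rewrite /graph_dist; case: pselect => [h|[]]; last by exists n; apply/asboolP.
by case: ex_minnP => k /asboolP.
Qed.

Hypothesis conn : forall x y, exists n, walk E n x y.

Lemma dist_walk x y : walk E (graph_dist E x y) x y.
Proof. by have [n] := conn x y; apply: graph_dist_walk. Qed.

Lemma dist_refl x : graph_dist E x x = 0.
Proof. by apply/eqP; rewrite -leqn0; apply: graph_dist_le. Qed.

Lemma dist_eq0 x y : graph_dist E x y = 0 -> x = y.
Proof. by move=> d0; have := dist_walk x y; rewrite d0. Qed.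

Lemma dist_triangle y x z : graph_dist E x z <= graph_dist E x y + graph_dist E y z.
Proof. by apply: graph_dist_le; apply: walk_cat; apply: dist_walk. Qed.

Lemma dist_sym (symE : forall x y, E x y -> E y x) x y :
  graph_dist E x y = graph_dist E y x.
Proof.
by apply/eqP; rewrite eqn_leq !graph_dist_le //; apply: walk_sym => //; apply: dist_walk.
Qed.

End Walks.

Section QuadrangleCondition.
Variable X : cube_complex.
Hypotheses (simply_conn : simply_connected X) (flag : forall v : X, flag_link v).
Implicit Types (u v w x y : X) (p q r s : seq X).

Let conn v w : exists n, walk (@adjacent X) n v w.
Proof. by case: simply_conn => -[]. Qed.

Let d := @vdist X.

Definition normal_form p := foldl (@extend X) [::] p.

Lemma foldl_extend_reduced s p : reduced s -> reduced (foldl (@extend X) s p).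
Proof. by elim: p s => //= x p IH s /(extend_reduced flag)/IH. Qed.

Lemma foldl_extend_moves s t p : moves s t ->
  moves (foldl (@extend X) s p) (foldl (@extend X) t p).
Proof. by elim: p s t => //= x p IH s t m; apply: IH; apply: extend_moves. Qed.

Lemma reduced_nil : reduced ([::] : seq X).
Proof. by move=> q /moves_size; case: q => // _ bq; inversion bq. Qed.

Lemma normal_form_homotopic p q : homotopic p q -> moves (normal_form p) (normal_form q).
Proof.
elim=> [{}p {}q e|{}p|{}p {}q _ m|p1 p2 p3 _ m12 _ m23].
- case: e => [r0 v w q0 vw|r0 a0 b c d0 q0 sq]; rewrite /normal_form !foldl_cat /=;
  apply: foldl_extend_moves.
  + have := extend_reduced flag (w := v) (foldl_extend_reduced (p := r0) reduced_nil).
    set s := foldl _ _ _; have [t ->] := extend_head s v; exact: extendK.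
  + have := extend_reduced flag (w := a0) (foldl_extend_reduced (p := r0) reduced_nil).
    set s := foldl _ _ _; have [t ->] := extend_head s a0; exact: extend_square.
- exact: moves_refl.
- exact: moves_sym.
- exact: moves_trans m23.
Qed.

Lemma normal_form_reduced p : reduced p -> moves (normal_form (rev p)) p.
Proof.
elim: p => [|w p IH] red; first exact: moves_refl.
rewrite rev_cons -cats1 /normal_form foldl_cat /=.
apply: moves_trans (extend_moves flag _ (IH (reduced_tail red))) _.
case: p red {IH} => [|v r] red; first exact: moves_refl.
rewrite extend_append; first exact: moves_refl.
case=> r' m; apply: (red [:: w, v, w & r']); last exact: backtracks_head.
exact: moves_cons.
Qed.

Lemma there_and_back v r p : reduced (v :: r) ->
  moves (foldl (@extend X) (v :: r) (p ++ rev (belast v p))) (v :: r).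
Proof.
elim: p v r => [|x p IH] v r red; first exact: moves_refl.
rewrite /= rev_cons -cats1 catA foldl_cat /=.
have := extend_reduced flag (w := x) red; have [t e] := extend_head (v :: r) x.
rewrite e => red'; apply: moves_trans (extend_moves flag _ (IH _ _ red')) _.
by rewrite -e; apply: extendK.
Qed.

Lemma edge_path_cat v p q :
  edge_path v (p ++ q) <-> edge_path v p /\ edge_path (last v p) q.
Proof.
elim: p v => [|x p IH] v /=; first by split=> // -[].
by rewrite IH; split=> [[? []]|[[]]].
Qed.

Lemma last_rev_belast v p : last (last v p) (rev (belast v p)) = v.
Proof. by case: p => //= y p; rewrite rev_cons last_rcons. Qed.

Lemma edge_path_rev v p : edge_path v p -> edge_path (last v p) (rev (belast v p)).
Proof.
elim: p v => [|x p IH] v //= [vx /IH xp]; rewrite rev_cons -cats1 edge_path_cat.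
by split=> //=; split=> //; rewrite last_rev_belast; apply: adjacent_sym.
Qed.

(** Going along [p] and back along [q] is null-homotopic, so that following [q]
    afterwards gives on the one hand the normal form of [q], and on the other
    hand that of [p], by [there_and_back]. *)
Lemma foldl_extend_uniq v p q : edge_path v p -> edge_path v q -> last v p = last v q ->
  moves (foldl (@extend X) [:: v] p) (foldl (@extend X) [:: v] q).
Proof.
move=> vp vq pq; have rq := edge_path_rev vq.
set q' := rev (belast v q) in rq.
have lq' : last (last v q) q' = v by exact: last_rev_belast.
have closed : edge_path v (p ++ q') by rewrite edge_path_cat pq.
have [_ /(_ _ _ closed)] := simply_conn.
rewrite last_cat pq => /(_ lq') /normal_form_homotopic.
rewrite /normal_form /= => m.
have := foldl_extend_moves q m; rewrite -foldl_cat => m'.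
apply: moves_trans m'; rewrite -catA foldl_cat.
have : reduced (foldl (@extend X) [:: v] p) by apply/foldl_extend_reduced/reduced1.
have [r ->] : exists r, foldl (@extend X) [:: v] p = last v q :: r.
  rewrite -pq; elim/last_ind: (p) => [|p' x _]; first by exists [::].
  by rewrite -cats1 foldl_cat /= last_cat; apply: extend_head.
move=> red; apply: moves_sym.
suff e : rev (belast (last v q) q') = q.
  by have := there_and_back q' red; rewrite e.
have := lastI (last v q) q'; rewrite lq' /q' -rev_rcons -lastI rev_cons.
by move=> /rcons_inj[<-]; rewrite revK.
Qed.

Lemma reduced_uniq u p q : edge_path u p -> edge_path u q -> last u p = last u q ->
  reduced (u :: p) -> reduced (u :: q) -> moves (u :: p) (u :: q).
Proof.
have fwd v r : edge_path v r -> reduced (v :: r) ->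
    moves (v :: r) (foldl (@extend X) [:: last v r] (rev (belast v r))).
  move=> vr /normal_form_reduced /moves_sym.
  by rewrite lastI rev_rcons.
move=> up uq pq rp rq; apply: moves_trans (fwd _ _ up rp) _.
apply: moves_trans (moves_sym (fwd _ _ uq rq)).
rewrite -pq; apply: foldl_extend_uniq.
- exact: edge_path_rev.
- by rewrite pq; apply: edge_path_rev.
- by rewrite last_rev_belast pq last_rev_belast.
Qed.

Definition chain p := if p is v :: r then edge_path v r else True.

Lemma move_chain p q : move p q -> chain p -> chain q.
Proof.
elim=> [a b c e r sq /= [_ [_ ar]]|x {}p {}q pq IH].
  have sq3 := square_rot (square_rot (square_rot sq)).
  have sq3' := square_rot (square_rot (square_rot (square_flip sq))).
  by split; [apply: adjacent_sym; exact: square_adj sq3'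
            |split=> //; exact: square_adj sq3].
case: p pq IH => [|y p] pq IH; first by inversion pq.
have [q' e] := move_headE pq; rewrite {}e in pq IH *.
by move=> /= [xy /IH].
Qed.

Lemma moves_chain p q : moves p q -> chain p -> chain q.
Proof. by elim=> // {}p {}q r /move_chain pq _ IH /pq. Qed.

Lemma backtracks_shorten v p : backtracks (v :: p) -> edge_path v p ->
  exists q, [/\ edge_path v q, last v q = last v p & size q < size p].
Proof.
move El : (v :: p) => l bl; elim: bl v p El => [x y q|x q bq IH] v p [-> ->] /=.
  by case=> _ [_ xq]; exists q; split=> //=; lia.
case: q bq IH => [|y q] bq IH; first by inversion bq.
case=> xy yq; have [q' [yq' lq sq]] := IH _ _ (erefl _) yq.
by exists (y :: q').
Qed.

Lemma walk_edge_path n v w : walk (@adjacent X) n v w <->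
  exists p, [/\ edge_path v p, last v p = w & size p = n].
Proof.
elim: n v => [|n IH] v /=; split.
- by move=> ->; exists [::].
- by case=> -[|u p] [_ <- sz] //; inversion sz.
- by case=> u [vu /IH[p [up pw <-]]]; exists (u :: p).
- by case=> -[|u p] [] //= [vu up] pw [sp]; exists u; split=> //; apply/IH; exists p.
Qed.

Lemma geodesic_reduced v p : edge_path v p -> size p = d v (last v p) -> reduced (v :: p).
Proof.
move=> vp sp q m bq; have [q' e] := moves_headE m; rewrite {}e in m bq.
have vq := moves_chain m vp; have [r [vr lr sr]] := backtracks_shorten bq vq.
have := moves_size m; have := moves_last v m; rewrite /= => lq [sq].
have : d v (last v p) <= size r.
  by apply: graph_dist_le; apply/walk_edge_path; exists r; rewrite lr lq.
by rewrite -sp sq leqNgt sr.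
Qed.

(** The paths from [o] to [u] through [w1] and through [w2] are geodesics, hence
    reduced, hence equal up to moves, and exchange provides the square. *)
Lemma quadrangle_condition o u w1 w2 : adjacent u w1 -> adjacent u w2 -> w1 <> w2 ->
    (d w1 o).+1 = d u o -> (d w2 o).+1 = d u o ->
  exists2 x, square u w1 x w2 & d x o < d w1 o.
Proof.
move=> uw1 uw2 nw dw1 dw2.
have geo w : adjacent u w -> (d w o).+1 = d u o ->
    exists p, [/\ edge_path u (w :: p), last w p = o, reduced [:: u, w & p] & size p = d w o].
  move=> uw dw; have [p [wp po sp]] := (walk_edge_path _ _ _).1 (dist_walk conn w o).
  exists p; split=> //; apply: geodesic_reduced => //=; by rewrite po sp.
have [p1 [up1 po1 red1 sp1]] := geo _ uw1 dw1.
have [p2 [up2 po2 red2 sp2]] := geo _ uw2 dw2.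
have m : moves [:: u, w1 & p1] [:: u, w2 & p2].
  by apply: reduced_uniq => //=; rewrite po1 po2.
case: (exchange flag m) => [m'|[w1' [w2' [x [s [m1 m2 sq]]]]]].
  by have [_ [e _]] := moves_headE m'; case: nw; rewrite e.
have [_ [e _]] := moves_headE m1; rewrite {}e in m1 sq.
have [_ [e _]] := moves_headE m2; rewrite {}e in m2 sq.
exists x => //; have ch := moves_chain m1 up1.2; have l := moves_last w1 m1.
have sz := moves_size m1.
rewrite -sp1; have -> : size p1 = (size s).+1 by case: sz.
rewrite ltnS; apply: graph_dist_le; apply/walk_edge_path; exists s; split=> //.
  by case: ch.
by rewrite -po1 -[last w1 p1]/(last w1 (w1 :: p1)) l.
Qed.

(** Elementary homotopies preserve the parity of lengths, so that the graph is
    bipartite. *)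
Lemma homotopic_odd p q : homotopic p q -> odd (size p) = odd (size q).
Proof.
elim=> [{}p {}q e|//|//|? ? ? _ -> _ -> //].
by case: e => *; rewrite !size_cat //= !oddD /=; case: (odd _); rewrite ?negbK.
Qed.

Lemma dist_adj_neq o u w : adjacent u w -> d u o <> d w o.
Proof.
move=> uw e.
have [p [up pw sp]] := (walk_edge_path _ _ _).1 (dist_walk conn u o).
have [q [wq qo sq]] := (walk_edge_path _ _ _).1 (dist_walk conn w o).
have closed : edge_path w (u :: p ++ rev (belast w q)).
  split; first exact: adjacent_sym.
  by rewrite edge_path_cat pw -qo; split=> //; apply: edge_path_rev.
have [_ /(_ _ _ closed)] := simply_conn.
rewrite /= last_cat pw -{1}qo last_rev_belast => /(_ (erefl _)) /homotopic_odd.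
have spq : size p = size q by rewrite sp sq.
by rewrite /= size_cat size_rev size_belast spq oddD addbb.
Qed.

End QuadrangleCondition.

(** * The cube complex of a discrete median algebra *)

Definition majority (a b c : bool) := [|| a && b, a && c | b && c].

Section Halfspaces.
Variables (V : Type) (med : V -> V -> V -> V).

(** Halfspaces are encoded by their indicator functions, the median homomorphisms to
    [bool]. As points are separated by them, identities between medians are checked
    on booleans. *)
Definition halfspace (h : V -> bool) : Prop :=
  forall x y z, h (med x y z) = majority (h x) (h y) (h z).

Definition separated : Prop :=
  forall x y, (forall h, halfspace h -> h x = h y) -> x = y.

(* The interval between [x] and [y], as the intersection of the halfspaces that
   contain both. *)
Definition between (x t y : V) : Prop :=
  forall h, halfspace h -> h x = h y -> h t = h x.

End Halfspaces.

Section MedianComplex.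
Variables (V : Type) (med : V -> V -> V -> V) (d : V -> V -> nat).
Hypothesis sep : separated med.
Hypothesis d_between : forall x t y, between med x t y -> d x y = d x t + d t y.
Hypothesis d_eq0 : forall x y, d x y = 0 -> x = y.

Local Notation hs := (halfspace med).
Local Notation btw := (between med).
Implicit Types (u v w : V) (h : V -> bool).

Lemma between_med1 x y z : btw x (med x y z) y.
Proof. by move=> h hh; rewrite hh => ->; rewrite /majority; case: (h y); case: (h z). Qed.
Arguments between_med1 : clear implicits.

Lemma between_med2 x y z : btw x (med x y z) z.
Proof. by move=> h hh; rewrite hh => ->; rewrite /majority; case: (h y); case: (h z). Qed.
Arguments between_med2 : clear implicits.

Lemma between_med3 x y z : btw y (med x y z) z.
Proof. by move=> h hh; rewrite hh => ->; rewrite /majority; case: (h x); case: (h z). Qed.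
Arguments between_med3 : clear implicits.

Lemma between_right x y : btw x y y. Proof. by move=> h _ ->. Qed.
Arguments between_right : clear implicits.

Lemma between_sym x t y : btw x t y -> btw y t x.
Proof. by move=> b h hh e; rewrite (b h hh). Qed.

Lemma between_trans x t u y : btw x u y -> btw x t u -> btw x t y.
Proof. by move=> bu bt h hh e; rewrite (bt h) // (bu h). Qed.

Lemma between_same x t : btw x t x -> t = x.
Proof. by move=> b; apply: sep => h hh; apply: b. Qed.

Definition median_adjacent x y :=
  x <> y /\ forall t, btw x t y -> t = x \/ t = y.

Local Notation adjm := median_adjacent.

Lemma median_adjacent_sym x y : adjm x y -> adjm y x.
Proof.
by case=> ne b; split=> [/esym//|t /between_sym /b []]; [right|left].
Qed.

(** The median of [x], [t], [y] is [x] or [y]. Thus the halfspaces separating two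
    adjacent points all agree, up to complement: they form one wall. *)
Lemma adjacent_side x y t : adjm x y ->
  (forall h, hs h -> h x != h y -> h t = h x) \/
  (forall h, hs h -> h x != h y -> h t = h y).
Proof.
case=> _ /(_ _ (between_med2 x t y)) [] e; [left|right] => h hh;
by have := hh x t y; rewrite e /majority; case: (h x); case: (h y); case: (h t).
Qed.

Lemma adjacent_bundle x y h h' t t' : adjm x y -> hs h -> hs h' ->
  h x != h y -> h' x != h' y -> h t (+) h' t = h t' (+) h' t'.
Proof.
move=> xy hh hh' n n'.
have side s : h s (+) h' s = h x (+) h' x.
  case: (adjacent_side s xy) => H; rewrite (H h) // (H h') //.
  by move: n n'; case: (h x); case: (h y); case: (h' x); case: (h' y).
by rewrite !side.
Qed.

Lemma exists_adjacent x y : x <> y -> exists2 z, adjm x z & btw x z y.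
Proof.
have [n] := ubnP (d x y); elim: n y => // n IH y /ltnSE dn ne.
have [b|] := pselect (forall t, btw x t y -> t = x \/ t = y).
  by exists y => //; apply: between_right.
move=> /existsNP[t /not_implyP[bt /not_orP[tx ty]]].
have dt := d_between bt.
have [|/esym//|z xz bz] := IH t.
  by apply: leq_trans dn; rewrite dt -[ltnLHS]addn0 ltn_add2l lt0n; apply/eqP => /d_eq0.
by exists z => //; apply: between_trans bz.
Qed.

(** [D i] is the set of the halfspaces crossed by the edges of [f] in the direction
    [i]. The third condition says that they define a single wall, which makes these
    edges edges of the median algebra. *)
Definition has_bundles n (f : cube_vertex n -> V) (D : 'I_n -> (V -> bool) -> Prop) :=
  [/\ forall i, exists h, D i h,
      forall i h, D i h -> hs h,
      forall i h h' t t', D i h -> D i h' -> h t (+) h' t = h t' (+) h' t',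
      forall i h (x : cube_vertex n), D i h -> h (f x) = h (f (origin n)) (+) x i &
      forall h (x : cube_vertex n), hs h -> (forall i, ~ D i h) -> h (f x) = h (f (origin n))].

Definition median_cube n (f : cube_vertex n -> V) := exists D, has_bundles f D.

Section Bundles.
Variables (n : nat) (f : cube_vertex n -> V) (D : 'I_n -> (V -> bool) -> Prop).
Hypothesis fD : has_bundles f D.

Lemma bundle_hs i h : D i h -> hs h.
Proof. by case: fD => _ + _ _ _; apply. Qed.

Lemma bundle_nonempty i : exists h, D i h.
Proof. by case: fD. Qed.

Lemma bundle_parallel i h h' t t' : D i h -> D i h' ->
  h t (+) h' t = h t' (+) h' t'.
Proof. by case: fD => _ _ + _ _; apply. Qed.

Lemma bundle_flip i h (x y : cube_vertex n) : D i h -> h (f x) = h (f y) (+) (x i (+) y i).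
Proof.
case: fD => _ _ _ E _ Dih; rewrite (E _ _ x Dih) (E _ _ y Dih).
by case: (h _); case: (x i); case: (y i).
Qed.

Lemma bundle_const h (x y : cube_vertex n) : hs h -> (forall i, ~ D i h) -> h (f x) = h (f y).
Proof. by case: fD => _ _ _ _ E hh nD; rewrite (E h x) // (E h y). Qed.

Lemma bundle_disjoint i j h : D i h -> D j h -> i = j.
Proof.
move=> Di Dj; have := bundle_flip (unit_vertex i) (origin n) Dj.
rewrite (bundle_flip (unit_vertex i) (origin n) Di) !ffunE eqxx.
by case: eqP => // _; case: (h _).
Qed.

Lemma bundle_unit i h : hs h ->
  (h (f (origin n)) != h (f (unit_vertex i))) <-> D i h.
Proof.
move=> hh; split=> [ne|Dih]; last first.
  by rewrite (bundle_flip (unit_vertex i) (origin n) Dih) !ffunE eqxx; case: (h _).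
have [[j Djh]|nD] := pselect (exists j, D j h); last first.
  by move: ne; rewrite (@bundle_const h _ (unit_vertex i)) ?eqxx // => j Dj; apply: nD; exists j.
move: ne; rewrite (bundle_flip (unit_vertex i) (origin n) Djh) !ffunE.
by have [<-//|_] := eqVneq j i; case: (h _).
Qed.

Lemma median_cube_inj : injective f.
Proof.
move=> x y fxy; apply/ffunP => i; have [h Dih] := bundle_nonempty i.
have := bundle_flip x y Dih; rewrite fxy.
by case: (h _); case: (x i); case: (y i).
Qed.

Lemma bundle_adjacent i : adjm (f (origin n)) (f (unit_vertex i)).
Proof.
split=> [/median_cube_inj/ffunP/(_ i)|t bt]; first by rewrite !ffunE eqxx.
have [h0 Dh0] := bundle_nonempty i.
have agree (x : cube_vertex n) : h0 t = h0 (f x) -> x = origin n \/ x = unit_vertex i -> t = f x.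
  move=> e ex; apply: sep => h hh.
  have [Dih|nDih] := pselect (D i h).
    by have := bundle_parallel t (f x) Dih Dh0; rewrite e => /addIb.
  have e0 : h (f (origin n)) = h (f (unit_vertex i)).
    by apply/eqP/negPn/negP => /(bundle_unit i hh).
  by rewrite (bt h hh e0); case: ex => -> //.
have := agree (origin n); have := agree (unit_vertex i).
rewrite (bundle_flip (unit_vertex i) (origin n) Dh0) !ffunE eqxx addbT.
case: (h0 t); case: (h0 _) => /= H H'; try (by left; apply: H' => //; left);
by right; apply: H => //; right.
Qed.

End Bundles.

Lemma median_cube_vertex v : median_cube (fun _ : cube_vertex 0 => v).
Proof. by exists (fun _ _ => False); split=> // -[]. Qed.

Lemma median_cube_face k n (f : cube_vertex n -> V) (s : 'I_k -> 'I_n) b :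
  median_cube f -> injective s -> median_cube (f \o face_map s b).
Proof.
case=> D fD s_inj; exists (fun i => D (s i)); split.
- by move=> i; apply: (bundle_nonempty fD).
- by move=> i h Di; apply: (bundle_hs fD Di).
- by move=> i h h' t t' Di Di'; apply: (bundle_parallel fD t t' Di Di').
- move=> i h x Dh /=; rewrite (bundle_flip fD _ (face_map s b (origin k)) Dh).
  by rewrite !face_map_in // ffunE; case: (b _); case: (x i); case: (h _).
- move=> h x hh nD /=; have [[j Djh]|nD'] := pselect (exists j, D j h); last first.
    by apply: (bundle_const fD) => // j Dj; apply: nD'; exists j.
  rewrite (bundle_flip fD _ (face_map s b (origin k)) Djh).
  by rewrite !face_map_out ?addbb ?addbF // => i; apply/eqP => sij; apply: (nD i); rewrite sij.
Qed.

(** Two bundles with a common halfspace are equal, since one can be read off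
    from the trace of any of its halfspaces. *)
Lemma bundle_eq m n (f : cube_vertex m -> V) (g : cube_vertex n -> V) D E i j h0 :
  has_bundles f D -> has_bundles g E -> D i h0 -> E j h0 ->
  forall h, D i h -> E j h.
Proof.
move=> fD gE Dh0 Eh0 h Dh; apply/(bundle_unit gE j (bundle_hs fD Dh)).
have := bundle_parallel fD (g (origin n)) (g (unit_vertex j)) Dh Dh0.
have /(bundle_unit gE j (bundle_hs gE Eh0)) := Eh0.
by case: (h0 _); case: (h0 _); case: (h _); case: (h _).
Qed.

(** The intersection of two cubes with a common vertex is the face of each of them
    in the directions whose bundles occur in both. *)
Lemma median_cube_meet m n (f : cube_vertex m -> V) (g : cube_vertex n -> V) :
  median_cube f -> median_cube g -> (exists x y, f x = g y) ->
  exists k (s : 'I_k -> 'I_m) b (t : 'I_k -> 'I_n) c,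
      [/\ injective s, injective t,
          forall z, f (face_map s b z) = g (face_map t c z) &
          forall x y, f x = g y ->
            exists z, x = face_map s b z /\ y = face_map t c z].
Proof.
case=> D fD [E gE] [x0 [y0 e0]].
pose common i j := exists h, D i h /\ E j h.
pose A := [set i | `[< exists j, common i j >]]%SET.
pose s (l : 'I_#|A|) : 'I_m := enum_val l.
have sP l : exists j, common (s l) j.
  by have := enum_valP l; rewrite inE => /asboolP.
pose t l := projT1 (cid (sP l)).
have st l : common (s l) (t l) by rewrite /t; case: cid.
have s_inj : injective s by apply: enum_val_inj.
have Ds l h : D (s l) h <-> E (t l) h.
  have [h0 [Dh0 Eh0]] := st l; split; first exact: (bundle_eq fD gE Dh0 Eh0).
  exact: (bundle_eq gE fD Eh0 Dh0).
have t_inj : injective t.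
  move=> l l' tl; have [h [_ Eh]] := st l.
  by apply: s_inj; apply: (bundle_disjoint fD); apply/Ds; [|rewrite -tl]; exact: Eh.
have sD i h j : D i h -> E j h -> exists2 l, s l = i & t l = j.
  move=> Di Ej; have iA : i \in A by rewrite inE; apply/asboolP; exists j, h.
  exists (enum_rank_in iA i); first exact: enum_rankK_in.
  by apply: (bundle_disjoint gE (h := h)) => //; apply/Ds; rewrite /s enum_rankK_in.
exists #|A|, s, x0, t, y0; split=> //.
  move=> z; apply: sep => h hh.
  have [[l Dl]|nl] := pselect (exists l, D (s l) h).
    rewrite (bundle_flip fD _ x0 Dl) (bundle_flip gE _ y0 ((Ds l h).1 Dl)) e0.
    by rewrite !face_map_in //; case: (x0 _); case: (y0 _); case: (z l).
  transitivity (h (f x0)).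
    have [[i Di]|ni] := pselect (exists i, D i h); last first.
      by apply: (bundle_const fD) => // i Di; apply: ni; exists i.
    rewrite (bundle_flip fD _ x0 Di) face_map_out ?addbb ?addbF // => l.
    by apply/eqP => si; apply: nl; exists l; rewrite si.
  rewrite e0.
  have [[i Ei]|ni] := pselect (exists i, E i h); last first.
    by apply: (bundle_const gE) => // i Ei; apply: ni; exists i.
  rewrite [RHS](bundle_flip gE _ y0 Ei) face_map_out ?addbb ?addbF // => l.
  by apply/eqP => si; apply: nl; exists l; apply/Ds; rewrite si.
move=> x y fg; exists [ffun l => x (s l) (+) x0 (s l)].
have xy i j h : D i h -> E j h -> x i (+) x0 i = y j (+) y0 j.
  move=> Di Ej; have := bundle_flip fD x x0 Di; have := bundle_flip gE y y0 Ej.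
  rewrite fg e0 => ->.
  by case: (h _); case: (x i); case: (x0 i); case: (y j); case: (y0 j).
split; apply/ffunP => i.
  have [[l <-]|nl] := pselect (exists l, s l = i).
    by rewrite face_map_in // ffunE; case: (x0 _); case: (x _).
  rewrite face_map_out; last by move=> l; apply/eqP => sl; apply: nl; exists l.
  have [h Di] := bundle_nonempty fD i; have hh := bundle_hs fD Di.
  have := bundle_flip fD x x0 Di; rewrite fg e0 (bundle_const gE y y0) //.
    by case: (h _); case: (x i); case: (x0 i).
  by move=> j Ej; apply: nl; have [l] := sD _ _ _ Di Ej; exists l.
have [[l <-]|nl] := pselect (exists l, t l = i).
  have [h [Dl El]] := st l.
  by rewrite face_map_in // ffunE (xy _ _ _ Dl El); case: (y0 _); case: (y _).
rewrite face_map_out; last by move=> l; apply/eqP => sl; apply: nl; exists l.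
have [h Ei] := bundle_nonempty gE i; have hh := bundle_hs gE Ei.
have := bundle_flip gE y y0 Ei; rewrite -fg -e0 (bundle_const fD x x0) //.
  by case: (h _); case: (y i); case: (y0 i).
by move=> j Dj; apply: nl; have [l] := sD _ _ _ Dj Ei; exists l.
Qed.

Definition median_complex : cube_complex :=
  @CubeComplex V median_cube median_cube_vertex
    (fun n f fc => let: ex_intro D fD := fc in median_cube_inj fD)
    median_cube_face median_cube_meet.

End MedianComplex.

Arguments between_med1 {V} med x y z h _ _.
Arguments between_med2 {V} med x y z h _ _.
Arguments between_med3 {V} med x y z h _ _.

Section MedianCat0.
Variables (V : Type) (med : V -> V -> V -> V) (d : V -> V -> nat).
Hypothesis sep : separated med.
Hypothesis d_between : forall x t y, between med x t y -> d x y = d x t + d t y.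
Hypothesis d_eq0 : forall x y, d x y = 0 -> x = y.

Local Notation hs := (halfspace med).
Local Notation btw := (between med).
Local Notation adjm := (median_adjacent med).
Local Notation Y := (median_complex sep).
Implicit Types (u v w : V) (h : V -> bool).

Section Corner.
Variables (v : V) (n : nat) (a : 'I_n -> V).
Hypotheses (adj_a : forall i, adjm v (a i)) (a_inj : injective a).

(** A halfspace separating [v] from both [a i] and [a j] would identify the walls of
    the two edges, and thus [a i] with [a j]. *)
Lemma corner_disjoint h i j : hs h -> h v != h (a i) -> h v != h (a j) -> i = j.
Proof.
move=> hh hi hj; apply: a_inj; apply: sep => k hk.
have side i' j' : h v != h (a i') -> h v != h (a j') ->
    forall k, hs k -> k v != k (a i') -> k (a j') = k (a i').
  move=> hi' hj'; case: (adjacent_side (a j') (adj_a i')) => // H.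
  by have := H h hh hi'; move: hj'; case: (h v); case: (h _).
have := side _ _ hi hj k hk; have := side _ _ hj hi k hk.
case: (k v); case: (k (a i)); case: (k (a j)) => // H H';
by (discriminate (H isT) || discriminate (H' isT)).
Qed.

(** The vertex reached from the corner [v] of a cube by crossing the bundles of
    the edges to the points [a i], for [i] in [S]. *)
Definition corner_vertex (S : {set 'I_n}) q :=
  forall h, hs h ->
    (forall i, h v != h (a i) -> h q = h v (+) (i \in S)) /\
    ((forall i, h v = h (a i)) -> h q = h v).

(** The vertices at distance at least three from the corner are medians of
    vertices that are one step closer. *)
Lemma corner_vertices :
    (forall i j, i != j -> exists q, corner_vertex [set i; j]%SET q) ->
  forall S, exists q, corner_vertex S q.
Proof.
move=> pairs S; have [k] := ubnP #|S|; elim: k S => // k IH S /ltnSE cS.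
have [S0|[i iS]] := set_0Vmem S.
  exists v => h hh; split=> // i _; by rewrite S0 inE addbF.
have [Si0|[j jS]] := set_0Vmem (S :\ i).
  exists (a i) => h hh; split=> [j hj|/(_ i) //].
  have -> : (j \in S) = (j == i).
    have := congr1 (fun A : {set 'I_n} => j \in A) Si0; rewrite !inE.
    by case: eqP => [->|]; rewrite ?iS.
  have [ji|ji] := eqVneq j i; first by move: hj; rewrite ji; case: (h v); case: (h _).
  rewrite addbF; apply/esym/eqP/negPn/negP => hi.
  by move/eqP: ji; apply; apply: corner_disjoint hj hi.
have [Sij0|[l lS]] := set_0Vmem (S :\ i :\ j).
  have -> : S = [set i; j]%SET.
    apply/setP => l; have := congr1 (fun A : {set 'I_n} => l \in A) Sij0; rewrite !inE.
    have [->|_] /= := eqVneq l j; last by case: eqP => [->|]; rewrite ?iS // => _ ->.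
    by move: jS; rewrite !inE => /andP[_ ->]; rewrite orbT.
  by apply: pairs; move: jS; rewrite !inE eq_sym => /andP[].
have [ji jS'] : j != i /\ j \in S by move: jS; rewrite !inE => /andP[].
have [lj li lS'] : [/\ l != j, l != i & l \in S] by move: lS; rewrite !inE => /and3P[].
have small i' : i' \in S -> exists q, corner_vertex (S :\ i') q.
  by move=> iS'; apply: IH; apply: leq_trans cS; rewrite [ltnRHS](cardsD1 i') iS'.
have [q1 c1] := small _ iS; have [q2 c2] := small _ jS'; have [q3 c3] := small _ lS'.
exists (med q1 q2 q3) => h hh; rewrite hh.
have [a1 b1] := c1 h hh; have [a2 b2] := c2 h hh; have [a3 b3] := c3 h hh.
split=> [m hm|e]; last by rewrite b1 // b2 // b3 //; case: (h v).
rewrite (a1 m) // (a2 m) // (a3 m) // !inE.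
have [->|mi] := eqVneq m i.
  by rewrite iS eq_sym ji eq_sym li; case: (h v).
have [->|mj] := eqVneq m j.
  by rewrite jS' eq_sym lj; case: (h v).
have [->|ml] := eqVneq m l.
  by rewrite lS'; case: (h v).
by case: (m \in S); case: (h v).
Qed.

Lemma corner_vertex_uniq S q q' : corner_vertex S q -> corner_vertex S q' -> q = q'.
Proof.
move=> c c'; apply: sep => h hh; have [H1 H2] := c h hh; have [H1' H2'] := c' h hh.
have [[i hi]|nD] := pselect (exists i, h v != h (a i)); first by rewrite (H1 i) // (H1' i).
rewrite H2 ?H2' // => i; apply/eqP/negPn/negP => hi; by apply: nD; exists i.
Qed.

Lemma corner_cube :
    (forall i j, i != j -> exists q, corner_vertex [set i; j]%SET q) ->
  exists f : cube_vertex n -> V,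
    [/\ median_cube med f, f (origin n) = v, forall i, f (unit_vertex i) = a i &
        forall x : cube_vertex n, corner_vertex [set i | x i]%SET (f x)].
Proof.
move=> /corner_vertices ex.
pose f (x : cube_vertex n) := projT1 (cid (ex [set i | x i]%SET)).
have fP (x : cube_vertex n) : corner_vertex [set i | x i]%SET (f x) by rewrite /f; case: cid.
pose D i h := hs h /\ h v != h (a i).
have fD x i h : D i h -> h (f x) = h v (+) x i.
  by case=> hh hi; have [+ _] := fP x h hh => /(_ i hi); rewrite inE.
have fN x h : hs h -> (forall i, ~ D i h) -> h (f x) = h v.
  move=> hh nD; have [_] := fP x h hh; apply => i.
  by apply/eqP/negPn/negP => hi; apply: (nD i).
have f0 : f (origin n) = v.
  apply: sep => h hh; have [[i Di]|nD] := pselect (exists i, D i h).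
    by rewrite (fD _ _ _ Di) ffunE addbF.
  by apply: fN => // i Di; apply: nD; exists i.
exists f; split=> // [|i].
  exists D; split.
  - move=> i; apply: contrapT => nD; case: (adj_a i) => + _; apply.
    apply: sep => h hh; apply/eqP/negPn/negP => hi; by apply: nD; exists h.
  - by move=> i h [].
  - move=> i h h' t t' [hh hi] [hh' hi']; exact: (adjacent_bundle t t' (adj_a i)).
  - by move=> i h x Di; rewrite f0; apply: fD.
  - by move=> h x hh nD; rewrite f0; apply: fN.
apply: sep => h hh; have [[j Dj]|nD] := pselect (exists j, D j h).
  rewrite (fD _ _ _ Dj) ffunE; have [ji|ji] := eqVneq j i.
    by case: Dj => _; rewrite ji; case: (h v); case: (h _).
  rewrite addbF; apply/eqP/negPn/negP => hi.
  by move/eqP: ji; apply; apply: corner_disjoint hi; case: Dj.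
rewrite fN // => [|j Dj]; last by apply: nD; exists j.
by apply/eqP/negPn/negP => hi; apply: nD; exists i.
Qed.

End Corner.

Lemma adjacentE u w : @adjacent Y u w <-> adjm u w.
Proof.
split=> [[f [[D fD] <- <-]]|uw].
  by have := bundle_adjacent sep fD ord0; rewrite (_ : unit_vertex _ = apex 1) //;
     apply: cube_vertex1P; rewrite !ffunE.
have [||i j|f [fc f0 f1 _]] := @corner_cube u 1 (fun=> w).
- by [].
- by move=> i j _; rewrite !ord1.
- by rewrite !ord1.
exists f; split=> //; rewrite -(f1 ord0); congr f.
by apply: cube_vertex1P; rewrite !ffunE.
Qed.

Lemma square_corner v a b c : adjm v a -> adjm v b -> a <> b ->
    (forall h, hs h -> h c = h v (+) ((h v != h a) || (h v != h b))) ->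
  @square Y v a c b.
Proof.
move=> va vb ab hc; pose n2 (i : 'I_2) := if i == ord0 then a else b.
have adj_n i : adjm v (n2 i) by rewrite /n2; case: ifP.
have n2_inj : injective n2.
  by move=> i j; case: (ord2P i) => ->; case: (ord2P j) => -> // e;
     case: ab; (exact: e || exact: esym e).
have cc : corner_vertex v n2 [set: 'I_2]%SET c.
  move=> h hh; rewrite hc //; split=> [i|H].
    by rewrite inE /n2; case: ifP => _ ->; rewrite ?orbT.
  by rewrite {1}(H ord0) -(H ord_max) (H ord0) eqxx addbF.
have [i j ij|f [fc f0 f1 fx]] := corner_cube adj_n n2_inj.
  exists c; rewrite (_ : [set i; j]%SET = [set: 'I_2]%SET) //.
  apply/setP => k; rewrite !inE.
  by move: ij; case: (ord2P i) => ->; case: (ord2P j) => -> //; case: (ord2P k) => ->.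
exists f; split; [by []|by []|exact: (f1 ord0)| |exact: (f1 ord_max)].
apply: corner_vertex_uniq cc; have := fx (apex 2).
by rewrite (_ : [set i | apex 2 i]%SET = [set: 'I_2]%SET) //; apply/setP => k; rewrite !inE ffunE.
Qed.

(** Pairwise squares at [v] provide the vertices of a cube that are at distance two
    from [v]; [corner_cube] finds the others as medians. *)
Lemma median_complex_flag (v : Y) : flag_link v.
Proof.
move=> n a a_inj adj_a pairs.
have adj i : adjm v (a i) by apply/adjacentE.
have [i j ij|f [fc f0 f1 _]] := corner_cube adj a_inj; last by exists f.
have [f [[D fD] f0 f1]] := pairs i j ij.
have fi : f (unit_vertex ord0) = a i by rewrite f1.
have fj : f (unit_vertex ord_max) = a j by rewrite f1.
have ne k l h : hs h -> h v != h (a k) -> k != l -> h v = h (a l).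
  move=> hh hk kl; apply/eqP/negPn/negP => hl.
  by move/eqP: kl; apply; apply: corner_disjoint hk hl.
have D0 h : hs h -> h v != h (a i) <-> D ord0 h.
  by move=> hh; rewrite -f0 -fi; apply: bundle_unit fD ord0 h hh.
have D1 h : hs h -> h v != h (a j) <-> D ord_max h.
  by move=> hh; rewrite -f0 -fj; apply: bundle_unit fD ord_max h hh.
exists (f (apex 2)) => h hh; split=> [k hk|H].
  rewrite !inE; have [ki|ki] := eqVneq k i.
    move: hk; rewrite ki => /(D0 h hh) /(bundle_flip fD (apex 2) (origin 2)) ->.
    by rewrite f0 !ffunE.
  have [kj|kj] := eqVneq k j.
    move: hk; rewrite kj => /(D1 h hh) /(bundle_flip fD (apex 2) (origin 2)) ->.
    by rewrite f0 !ffunE.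
  rewrite addbF -f0; apply: (bundle_const fD) => // l; case: (ord2P l) => ->.
    by move=> /(D0 h hh); rewrite -(ne k i) ?eqxx.
  by move=> /(D1 h hh); rewrite -(ne k j) ?eqxx.
rewrite -f0; apply: (bundle_const fD) => // l; case: (ord2P l) => ->.
  by move=> /(D0 h hh); rewrite -H ?eqxx.
by move=> /(D1 h hh); rewrite -H ?eqxx.
Qed.

(** ** Simple connectivity *)

Lemma homotopic_trans p q r : @homotopic Y p q -> homotopic q r -> homotopic p r.
Proof. exact: rst_trans. Qed.

Lemma homotopic_sym p q : @homotopic Y p q -> homotopic q p.
Proof. exact: rst_sym. Qed.

Lemma homotopic_cat p q r : @homotopic Y p q -> homotopic (p ++ r) (q ++ r).
Proof.
elim=> [{}p {}q e|{}p|{}p {}q _|p1 p2 p3 _ m12 _].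
- apply: rst_step; case: e => [r0 v w q0 vw|r0 a0 b c d0 q0 sq]; rewrite -!catA /=.
    exact: Backtrack.
  exact: AcrossSquare.
- exact: rst_refl.
- exact: rst_sym.
- exact: rst_trans.
Qed.

(** The geodesics from [o], described inductively and written forwards. *)
Inductive outgoing (o : V) : V -> seq V -> Prop :=
| outgoing_refl : outgoing o o [:: o]
| outgoing_step u w p : outgoing o u p -> adjm u w -> btw o u w ->
    outgoing o w (p ++ [:: w]).

Lemma outgoing_last o u p : outgoing o u p -> exists q, p = q ++ [:: u].
Proof. by case=> [|{}u w {}p _ _ _]; [exists [::]|exists p]. Qed.

Lemma closer_lt o w u : adjm w u -> btw o w u -> d o w < d o u.
Proof.
move=> [ne _] /d_between ->; rewrite -[ltnLHS]addn0 ltn_add2l lt0n.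
by apply/eqP => /d_eq0.
Qed.

Lemma step_closer o u : u <> o -> exists w, [/\ adjm w u, btw o w u & d o w < d o u].
Proof.
move=> ne; have [w uw bw] := exists_adjacent d_between d_eq0 ne.
have wu := median_adjacent_sym uw; have {}bw := between_sym bw.
by exists w; split=> //; apply: closer_lt.
Qed.

Lemma outgoing_exists o u : exists p, outgoing o u p.
Proof.
have [n] := ubnP (d o u); elim: n u => // n IH u /ltnSE du.
have [->|/step_closer [w [wu bw dw]]] := pselect (u = o); first by exists [:: o]; constructor.
have [|p op] := IH w; first exact: leq_trans du.
by exists (p ++ [:: u]); apply: outgoing_step op wu bw.
Qed.

Lemma outgoing_inv o u p : outgoing o u p -> (u = o /\ p = [:: o]) \/
  exists w q, [/\ u <> o, outgoing o w q, adjm w u, btw o w u & p = q ++ [:: u]].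
Proof.
case=> [|{}u w {}p ou uw bw]; [by left|right; exists u, p; split=> // e].
by rewrite e in bw uw; case: uw => + _; apply; apply: between_same bw.
Qed.

(** If two outgoing paths reach [u] from [u1] and [u2], they are pushed across
    the square opposite to [u] at the median of [u1], [u2] and [o]. *)
Lemma outgoing_homotopic o u p q : outgoing o u p -> outgoing o u q ->
  @homotopic Y p q.
Proof.
have [n] := ubnP (d o u); elim: n u p q => // n IH u p q /ltnSE du op oq.
case: (outgoing_inv op) => [[uo ->]|[u1 [p1 [uo op1 u1u b1 ->]]]].
  case: (outgoing_inv oq) => [[_ ->]|[? [? [] //]]]; exact: rst_refl.
case: (outgoing_inv oq) => [[//]|[u2 [p2 [_ op2 u2u b2 ->]]]].
have du1 := leq_trans (closer_lt u1u b1) du; have du2 := leq_trans (closer_lt u2u b2) du.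
have [e|ne] := pselect (u1 = u2).
  by apply: homotopic_cat; apply: (IH u1) => //; rewrite e.
have uu1 := median_adjacent_sym u1u; have uu2 := median_adjacent_sym u2u.
pose x := med u1 u2 o.
have xE h : hs h -> h x = h u (+) ((h u != h u1) || (h u != h u2)).
  move=> hh; rewrite hh /majority.
  have := b1 h hh; have := b2 h hh.
  have : h u != h u1 -> h u2 = h u.
    move=> h1; apply/esym/eqP/negPn/negP => h2.
    pose a (i : 'I_2) := if i == ord0 then u1 else u2.
    have a_inj : injective a.
      by move=> i j; case: (ord2P i) => ->; case: (ord2P j) => -> // e;
         case: ne; (exact: e || exact: esym e).
    have adj_a i : adjm u (a i) by rewrite /a; case: ifP.
    by have := @corner_disjoint u 2 a adj_a a_inj h ord0 ord_max hh h1 h2.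
  case: (h o); case: (h u); case: (h u1); case: (h u2) => //= H H' H'';
  by (discriminate (H isT) || discriminate (H' erefl) || discriminate (H'' erefl)).
have sq := square_corner uu1 uu2 ne xE.
have xu1 : adjm x u1.
  by apply/adjacentE; apply: adjacent_sym; apply: square_adj (square_rot sq).
have xu2 : adjm x u2.
  by apply/adjacentE; apply: square_adj (square_rot (square_rot sq)).
have bx1 : btw o x u1 by apply: between_sym; apply: between_med2.
have bx2 : btw o x u2 by apply: between_sym; apply: between_med3.
have [r or] := outgoing_exists o x.
have r1 := homotopic_cat [:: u] (IH _ _ _ du1 op1 (outgoing_step or xu1 bx1)).
have r2 := homotopic_cat [:: u] (IH _ _ _ du2 op2 (outgoing_step or xu2 bx2)).
apply: homotopic_trans r1 _; apply: homotopic_sym; apply: homotopic_trans r2 _.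
have [r' ->] := outgoing_last or; rewrite -!catA /=.
apply: rst_step; apply: AcrossSquare; exact: square_rot (square_rot sq).
Qed.

Lemma adjacent_between o u w : adjm u w -> btw o u w \/ btw o w u.
Proof.
move=> uw; have wu := median_adjacent_sym uw.
by case: (uw) => _ /(_ _ (between_med2 med u o w)) [] e; [left|right];
   have := between_med3 med u o w; have := between_med1 med u o w;
   rewrite e => // b b'; apply: between_sym.
Qed.

(** An edge from [u] to [w] extends an outgoing path to [u], or else it retraces the
    last edge of an outgoing path to [u] through [w]. *)
Lemma path_outgoing o p q : @edge_path Y o p -> outgoing o (last o p) q ->
  @homotopic Y (o :: p) q.
Proof.
elim/last_ind: p q => [|p w IH] q.
  move=> _ oq; apply: outgoing_homotopic oq; exact: outgoing_refl.
rewrite -cats1 edge_path_cat /= last_cat /= => -[op [/adjacentE uw _]] oq.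
set u := last o p in uw.
have [r or] := outgoing_exists o u.
have := homotopic_cat [:: w] (IH r op or); rewrite /= => m.
apply: homotopic_trans m _.
case: (adjacent_between o uw) => b.
  by apply: outgoing_homotopic oq; apply: outgoing_step or uw b.
have wu := median_adjacent_sym uw.
have m := outgoing_homotopic or (outgoing_step oq wu b).
apply: homotopic_trans (homotopic_cat [:: w] m) _.
have [q' ->] := outgoing_last oq; rewrite -!catA /=.
apply: rst_step; apply: Backtrack; exact/adjacentE.
Qed.

Lemma median_complex_cat0 : (exists v : V, True) -> cat0 Y.
Proof.
move=> ne; split; last exact: median_complex_flag.
split=> [|o p op lp]; last by apply: path_outgoing => //; rewrite lp; apply: outgoing_refl.
split=> // o u; have [p op] := outgoing_exists o u.
elim: op => [|w u' q _ [n wn] wu _]; first by exists 0.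
exists (n + 1); apply: walk_cat wn (walk1 _); exact/adjacentE.
Qed.

End MedianCat0.

(** * The median algebra of a CAT(0) cube complex *)

Section Cat0.
Variable X : cube_complex.
Hypothesis hX : cat0 X.
Implicit Types (a b u v w x y z m o : X).

Local Notation d := (@vdist X).
Local Notation adj := (@adjacent X).

Lemma connected v w : exists n, walk adj n v w.
Proof. by case: hX => -[[]]. Qed.

Lemma vdist_sym x y : d x y = d y x.
Proof. by apply: dist_sym connected (@adjacent_sym X) x y. Qed.

Lemma vdist_refl x : d x x = 0.
Proof. exact: dist_refl. Qed.

Lemma vdist_eq0 x y : d x y = 0 -> x = y.
Proof. exact: (dist_eq0 connected). Qed.

Lemma vdist_triangle y x z : d x z <= d x y + d y z.
Proof. exact: (dist_triangle connected). Qed.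

Lemma vdist_adj x y : adj x y -> d x y <= 1.
Proof. by move=> xy; apply: graph_dist_le; apply: walk1. Qed.

(** Equality is excluded since the graph is bipartite. *)
Lemma vdist_step o x y : adj x y -> d x o = (d y o).+1 \/ d y o = (d x o).+1.
Proof.
move=> xy; have := vdist_adj xy; have := vdist_sym x y.
have := vdist_triangle y x o; have := vdist_triangle x y o.
have := @dist_adj_neq X hX.1 o _ _ xy; rewrite -!/(vdist _ _); lia.
Qed.

Lemma exists_closer x y : x <> y -> exists2 z, adj x z & d x y = (d z y).+1.
Proof.
move=> ne; have := dist_walk connected x y; rewrite -/(d x y).
case E : (d x y) => [|k] /=; first by have := vdist_eq0 E.
case=> z [xz zy]; have := graph_dist_le zy; rewrite -/(d z y) => zk; exists z => //.
by case: (vdist_step y xz); lia.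
Qed.

Lemma quadrangle o u w1 w2 : adj u w1 -> adj u w2 -> w1 <> w2 ->
  d u o = (d w1 o).+1 -> d u o = (d w2 o).+1 ->
  exists2 x, square u w1 x w2 & d x o < d w1 o.
Proof.
move=> u1 u2 ne d1 d2.
by apply: (quadrangle_condition hX.1 hX.2 u1 u2 ne); rewrite -!/(vdist _ _).
Qed.

Lemma on_geodesicP x y m : on_geodesic x y m <-> d x y = d x m + d m y.
Proof.
split=> [[i [j [wi wj e]]]|e].
  have := graph_dist_le wi; have := graph_dist_le wj.
  have := vdist_triangle m x y; rewrite -!/(vdist _ _); lia.
by exists (d x m), (d m y); split=> //; apply: dist_walk connected _ _.
Qed.

(** ** Halfspaces *)

(** For an edge from [a] to [b], the halfspace of [a]. *)
Definition side a b z := d z a < d z b.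

Lemma sideN a b z : adj a b -> side b a z = ~~ side a b z.
Proof.
by move=> ab; rewrite /side !(vdist_sym z); case: (vdist_step z ab); lia.
Qed.

Lemma sideP a b z : adj a b -> side a b z -> d z b = (d z a).+1.
Proof.
by move=> ab; rewrite /side !(vdist_sym z); case: (vdist_step z ab); lia.
Qed.

(** Otherwise the quadrangle condition at [b] would yield a second square on [b'],
    [b] and [a]. *)
Lemma side_square a b b' a' z : square a b b' a' -> side a b z -> side a' b' z.
Proof.
move=> sq; have ab := square_adj sq; have bb' := square_adj (square_rot sq).
have b'a' := square_adj (square_rot (square_rot sq)).
have a'a := square_adj (square_rot (square_rot (square_rot sq))).
move=> /(sideP ab) zab; rewrite -[side _ _ _]negbK -sideN; last exact: adjacent_sym.
apply/negP => /(sideP b'a') zab'.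
have [] := vdist_step z bb'; have [] := vdist_step z a'a; rewrite !(vdist_sym _ z); try lia.
move=> za' zb'; have [||t sqt] := quadrangle (o := z) (adjacent_sym ab) bb' (square_diag sq).
- by rewrite !(vdist_sym _ z).
- by rewrite !(vdist_sym _ z); lia.
have -> : t = a'.
  exact: square_uniq (square_rot (square_rot (square_rot sqt))) (square_flip sq).
rewrite !(vdist_sym _ z); lia.
Qed.

Lemma side_squareE a b b' a' z : square a b b' a' -> side a b z = side a' b' z.
Proof.
move=> sq; apply/idP/idP; apply: side_square => //.
exact: square_swap (square_rot (square_rot (square_rot sq))).
Qed.

(** Any edge between the two sides of an edge [(a, b)] is joined to it by a
    ladder of squares, so that it defines the same halfspaces. *)
Lemma side_crossing a b u v z : adj a b -> adj u v -> side a b u -> ~~ side a b v ->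
  side u v z = side a b z.
Proof.
move=> ab; have [n] := ubnP (d u a); elim: n u v => // n IH u v /ltnSE du uv su.
rewrite -sideN // => sv; have ua := sideP ab su; have vb := sideP (adjacent_sym ab) sv.
have uvE : d u a = d v b.
  have := vdist_triangle u v a; have := vdist_triangle v u b; have := vdist_adj uv.
  rewrite (vdist_sym v u); lia.
have [ua0|ne] := pselect (u = a).
  by have vb0 : v = b; [apply: vdist_eq0; rewrite -uvE ua0 vdist_refl|rewrite ua0 vb0].
have [u' uu' du'] := exists_closer ne.
have u'b : d u b = (d u' b).+1.
  have := vdist_triangle a u' b; have := vdist_adj ab; case: (vdist_step b uu'); lia.
have u'v : v <> u'.
  by move=> e; move: vb du'; rewrite e; lia.
have [||x sq xb] := quadrangle (o := b) uv uu' u'v; [lia|exact: u'b|].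
have u'x : adj u' x by apply: adjacent_sym; apply: square_adj (square_rot (square_rot sq)).
have xv : adj v x by apply: square_adj (square_rot sq).
rewrite (side_squareE z sq); apply: IH => //; first lia.
  by rewrite /side; lia.
rewrite -sideN // /side.
have := vdist_triangle x v a; have := vdist_adj xv; lia.
Qed.

Lemma crossing_edge a b x m : adj a b -> side a b x -> ~~ side a b m ->
  exists u v, [/\ adj u v, side a b u, ~~ side a b v &
                  d x m = d x u + (d v m).+1].
Proof.
move=> ab; have [n] := ubnP (d x m); elim: n x => // n IH x /ltnSE dn sx sm.
have [e|/exists_closer [x' xx' dx']] := pselect (x = m).
  by rewrite e (negPf sm) in sx.
case: (boolP (side a b x')) => sx'; last first.
  by exists x, x'; split=> //; rewrite vdist_refl.
have [|u [v [uv su sv e]]] := IH x' _ sx' sm; first by rewrite -ltnS -dx'.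
exists u, v; split=> //.
have := vdist_triangle x' x u; have := vdist_triangle u x m; have := vdist_triangle v u m.
have := vdist_adj xx'; have := vdist_adj uv; lia.
Qed.

(** A geodesic leaving the halfspace crosses an edge defining the same halfspace, from
    which it recedes: it never comes back. *)
Lemma side_convex a b x y m : adj a b -> side a b x -> side a b y ->
  d x y = d x m + d m y -> side a b m.
Proof.
move=> ab sx sy e; apply/negPn/negP => sm.
have [u [v [uv su sv em]]] := crossing_edge ab sx sm.
have := side_crossing y ab uv su sv; rewrite sy => /(sideP uv).
have := vdist_triangle u x y; have := vdist_triangle m v y.
rewrite !(vdist_sym y); lia.
Qed.

(** ** Medians *)

(** By induction along a geodesic from [m] to [z]: if it came closer to [x] after
    its first vertex [m1], the quadrangle condition at [m1] would provide a neighbour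
    of [m] on another geodesic to [z] that is closer to [x]. *)
Lemma local_geodesic x m z :
    (forall m', adj m m' -> d m z = (d m' z).+1 -> d m' x = (d m x).+1) ->
  d x z = d x m + d m z.
Proof.
have [n] := ubnP (d m z); elim: n m => // n IH m /ltnSE dn loc.
have [->|/exists_closer [m1 mm1 dm1]] := pselect (m = z).
  by rewrite vdist_refl addn0.
have xm1 := loc m1 mm1 dm1.
rewrite (IH m1) ?(vdist_sym x) ?xm1; [lia|lia|].
move=> m2 m12 dm2; case: (vdist_step x m12) => e; last by rewrite e xm1.
have mm2 : m <> m2 by move=> em; move: dm1 dm2; rewrite em; lia.
have [//|//|t sq dt] := quadrangle (o := x) (adjacent_sym mm1) m12 mm2.
have mt : adj m t by have := square_adj (square_rot sq).
have tm2 := vdist_adj (square_adj (square_rot (square_rot sq))).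
have := vdist_triangle m2 t z; case: (vdist_step z mt) => dt'; last lia.
by move=> _; have := loc t mt dt'; lia.
Qed.

(** A point closest to [z] in the interval from [x] to [y] is a median, by
    [local_geodesic]. *)
Lemma exists_median x y z : exists m, is_median x y z m.
Proof.
pose P n := `[< exists2 m, d x y = d x m + d m y & d m z = n >].
have exP : exists n, P n.
  by exists (d x z); apply/asboolP; exists x; rewrite ?vdist_refl.
case: (ex_minnP exP) => n /asboolP[m exy dm] min.
have closer m' : d m z = (d m' z).+1 -> d x y <> d x m' + d m' y.
  move=> dm' e; have := min (d m' z); rewrite -dm dm' ltnn => H.
  by suff : false by []; apply: H; apply/asboolP; exists m'.
exists m; split; apply/on_geodesicP => //; apply: local_geodesic => m' mm' /closer;
have := vdist_triangle m' x y; have := vdist_adj mm'; move: exy; rewrite !(vdist_sym x).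
- by case: (vdist_step y mm') => //; case: (vdist_step x mm'); lia.
- by case: (vdist_step x mm') => //; case: (vdist_step y mm'); lia.
Qed.

Local Notation med := (@median X).

Lemma medianP x y z : is_median x y z (med x y z).
Proof.
rewrite /median; case: pselect => [h|/(_ (exists_median x y z)) //].
by case: cid.
Qed.

Lemma side_median a b x y z m : adj a b -> is_median x y z m ->
  side a b m = majority (side a b x) (side a b y) (side a b z).
Proof.
move=> ab [/on_geodesicP xy /on_geodesicP yz /on_geodesicP xz].
have ba := adjacent_sym ab.
have := side_convex ab (x := x) (y := y) _ _ xy.
have := side_convex ab (x := y) (y := z) _ _ yz.
have := side_convex ab (x := x) (y := z) _ _ xz.
have := side_convex ba (x := x) (y := y) _ _ xy.
have := side_convex ba (x := y) (y := z) _ _ yz.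
have := side_convex ba (x := x) (y := z) _ _ xz.
rewrite !(sideN _ ab) /majority.
case: (side a b x); case: (side a b y); case: (side a b z); case: (side a b _) => //=;
by do 6 ((move/(_ isT isT) => //) || move=> _).
Qed.

Lemma side_halfspace a b : adj a b -> halfspace med (side a b).
Proof. by move=> ab x y z; apply: side_median => //; apply: medianP. Qed.

Lemma exists_side x y : x <> y -> exists u, [/\ adj x u, side x u x & ~~ side x u y].
Proof.
move=> /exists_closer [u xu e]; exists u; split=> //.
  rewrite /side vdist_refl lt0n; apply/eqP => /vdist_eq0.
  exact: adjacent_neq.
by rewrite -sideN // /side !(vdist_sym y) e.
Qed.

Lemma median_separated : separated med.
Proof.
move=> x y H; apply: contrapT => /exists_side [u [xu sx]].
by rewrite -(H _ (side_halfspace xu)) sx.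
Qed.

(** ** The median is Lipschitz *)

(** If only the sides of one edge separate [m] from [m'], then two consecutive
    edges from [m] towards [m'] would cross between these sides back and forth. *)
Lemma adjacent_separation x x' m m' : adj x x' ->
  (forall a b, adj a b -> side a b m != side a b m' -> side a b x != side a b x') ->
  d m m' <= 1.
Proof.
move=> xx' H; have [->|/exists_closer [m1 mm1 e1]] := pselect (m = m').
  by rewrite vdist_refl.
have [m1m'|/exists_closer [m2 m12 e2]] := pselect (m1 = m').
  by rewrite -m1m' vdist_adj.
have s1m' : ~~ side m m1 m' by rewrite -sideN // /side !(vdist_sym m') e1.
have s1m : side m m1 m.
  by rewrite /side vdist_refl lt0n; apply/eqP => /vdist_eq0; apply: adjacent_neq.
have s2m' : ~~ side m1 m2 m' by rewrite -sideN // /side !(vdist_sym m') e2.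
have s2m : side m1 m2 m.
  by rewrite /side; have := vdist_triangle m2 m m'; have := vdist_adj mm1; lia.
have s21 : side m1 m2 m1.
  by rewrite /side vdist_refl lt0n; apply/eqP => /vdist_eq0; apply: adjacent_neq.
have s11 : ~~ side m m1 m1.
  by rewrite -sideN // /side vdist_refl lt0n; apply/eqP => /vdist_eq0 /esym; apply: adjacent_neq.
have H1 := H _ _ mm1; rewrite s1m (negPf s1m') in H1; have {}H1 := H1 isT.
have H2 := H _ _ m12; rewrite s2m (negPf s2m') in H2; have {}H2 := H2 isT.
have x'x := adjacent_sym xx'.
have E a b : adj a b -> side a b x != side a b x' ->
    (forall z, side a b z = side x x' z) \/ (forall z, side a b z = ~~ side x x' z).
  move=> ab; case sx : (side a b x); case sx' : (side a b x') => // _; [left|right] => z.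
    by apply/esym; apply: side_crossing => //; rewrite ?sx ?sx'.
  by rewrite -sideN //; apply/esym; apply: side_crossing => //; rewrite ?sx ?sx'.
exfalso; case: (E _ _ mm1 H1) => E1; case: (E _ _ m12 H2) => E2;
  rewrite !E1 in s1m s1m' s11; rewrite !E2 in s2m s2m' s21;
  move: s1m s1m' s11 s2m s2m' s21;
  by case: (side _ _ m); case: (side _ _ m'); case: (side _ _ m1).
Qed.

Lemma median_lipschitz1 x x' y z : d (med x y z) (med x' y z) <= d x x'.
Proof.
have [n] := ubnP (d x x'); elim: n x => // n IH x /ltnSE dn.
have [->|/exists_closer [x1 xx1 e1]] := pselect (x = x'); first by rewrite vdist_refl.
have := IH x1; rewrite -ltnS -e1 ltnS => /(_ dn) le1.
have : d (med x y z) (med x1 y z) <= 1.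
  apply: (adjacent_separation xx1) => a b ab; rewrite !side_halfspace // /majority.
  by case: (side a b x); case: (side a b x1); case: (side a b y); case: (side a b z).
have := vdist_triangle (med x1 y z) (med x y z) (med x' y z); lia.
Qed.

Lemma median_sym12 x y z : med x y z = med y x z.
Proof.
by apply: median_separated => h hh; rewrite !hh /majority; case: (h x); case: (h y); case: (h z).
Qed.

Lemma median_sym13 x y z : med x y z = med z y x.
Proof.
by apply: median_separated => h hh; rewrite !hh /majority; case: (h x); case: (h y); case: (h z).
Qed.

Lemma median_lipschitz x y z x' y' z' :
  d (med x y z) (med x' y' z') <= d x x' + d y y' + d z z'.
Proof.
have := median_lipschitz1 x x' y z; have := median_lipschitz1 y y' x' z.
have := median_lipschitz1 z z' y' x'.
rewrite (median_sym12 y) (median_sym12 y') (median_sym13 z) (median_sym13 z').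
have := vdist_triangle (med x' y z) (med x y z) (med x' y' z').
have := vdist_triangle (med x' y' z) (med x' y z) (med x' y' z'); lia.
Qed.

Lemma median_uniq x y z m : is_median x y z m -> m = med x y z.
Proof.
move=> mm; apply: contrapT => /exists_side [u [mu sm]].
by rewrite (side_median mu (medianP x y z)) -(side_median mu mm) sm.
Qed.

End Cat0.

Local Open Scope classical_set_scope.

(** * Generated median subalgebras *)

Section Generated.
Variable X : cube_complex.
Hypothesis hX : cat0 X.
Implicit Types (u v w x y z : X) (A : set X) (l : seq X).

Local Notation d := (@vdist X).
Local Notation adj := (@adjacent X).
Local Notation med := (@median X).

Inductive generated A : X -> Prop :=
| generated_in x of A x : generated A x
| generated_median x y z of generated A x & generated A y & generated A z :
    generated A (med x y z).

Fixpoint iterated_medians A n : set X :=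
  if n is k.+1 then
    [set m | exists x y z, [/\ iterated_medians A k x, iterated_medians A k y,
                               iterated_medians A k z & m = med x y z]]
  else A.

Lemma median_id x : med x x x = x.
Proof.
by apply: (median_separated hX) => h hh; rewrite hh /majority; case: (h x).
Qed.

Lemma iterated_medians_le A m n x : m <= n -> iterated_medians A m x -> iterated_medians A n x.
Proof.
move=> /subnK <-; elim: (n - m) => // k IH /IH mx; rewrite addSn.
by exists x, x, x; rewrite median_id.
Qed.

Lemma generated_nonempty A x : generated A x -> exists a, A a.
Proof. by elim=> // {}x Ax; exists x. Qed.

(** The complement of the intersection of two halfspaces is closed under medians; if
    it contained [A], it would contain [x]. *)
Lemma generated_meets A x u u' : generated A x -> adj x u -> adj x u' ->
  exists a, [/\ A a, side x u a & side x u' a].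
Proof.
move=> gx xu xu'; apply: contrapT => none.
suff H y : generated A y -> ~~ (side x u y && side x u' y).
  by move: (H x gx); rewrite /side vdist_refl !lt0n;
     case: eqP => [/(vdist_eq0 hX)/(adjacent_neq xu)|];
     case: eqP => [/(vdist_eq0 hX)/(adjacent_neq xu')|].
elim=> [{}y Ay|y1 y2 y3 _ H1 _ H2 _ H3].
  by apply/negP => /andP[s s']; apply: none; exists y.
rewrite !(side_halfspace hX) // /majority; move: H1 H2 H3.
case: (side x u y1); case: (side x u y2); case: (side x u y3);
by case: (side x u' y1); case: (side x u' y2); case: (side x u' y3).
Qed.

(** One more halfspace costs one more iteration: three points that miss at most one
    of the halfspaces each, three different ones, have their median in all of
    them. The induction starts from pairs of halfspaces. *)
Lemma iterated_medians_sides A x k l : generated A x -> (forall u, List.In u l -> adj x u) ->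
    size l <= k.+2 ->
  exists2 y, iterated_medians A k y & forall u, List.In u l -> side x u y.
Proof.
move=> gx; elim: k l => [|k IH] l adj_l sl.
  case: l adj_l sl => [|u [|u' []]] // adj_l _.
  - by have [a Aa] := generated_nonempty gx; exists a.
  - have xu := adj_l u (or_introl erefl); have [a [Aa s _]] := generated_meets gx xu xu.
    by exists a => // _ [<-|[]].
  - have xu := adj_l u (or_introl erefl); have xu' := adj_l u' (or_intror (or_introl erefl)).
    have [a [Aa s s']] := generated_meets gx xu xu'.
    by exists a => // _ [<-|[<-|[]]].
have [sl'|] := leqP (size l) k.+2.
  have [y my sy] := IH l adj_l sl'; exists y => //.
  exact: iterated_medians_le my.
case: l adj_l sl => [|u1 [|u2 [|u3 l]]] // adj_l sl _.
have [|//|y1 m1 s1] := IH [:: u2, u3 & l].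
  by move=> u; move: (adj_l u) => /=; tauto.
have [|//|y2 m2 s2] := IH [:: u1, u3 & l].
  by move=> u; move: (adj_l u) => /=; tauto.
have [|//|y3 m3 s3] := IH [:: u1, u2 & l].
  by move=> u; move: (adj_l u) => /=; tauto.
exists (med y1 y2 y3); first by exists y1, y2, y3.
move=> u ul; rewrite (side_halfspace hX (adj_l u ul)) /majority.
move: (s1 u) (s2 u) (s3 u) ul => /= {}s1 {}s2 {}s3 [e|[e|[e|ul]]].
- by rewrite s2 ?s3 ?orbT //; tauto.
- by rewrite s1 ?s3 ?orbT //; tauto.
- by rewrite s1 ?s2 //; tauto.
- by rewrite s1 ?s2 //; tauto.
Qed.

Definition degree_le D := forall x, exists2 l, size l <= D & forall u, adj x u <-> List.In u l.

(** The intersection of the halfspaces at [x] of all the edges at [x] is reduced to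
    [x], so that the number of iterations is bounded by the degree. *)
Lemma generated_iterated_medians D A x : degree_le D -> generated A x ->
  iterated_medians A D x.
Proof.
move=> /(_ x) [l sl nl] gx; have [||y my sy] := @iterated_medians_sides A x D l gx.
- by move=> u /nl.
- by apply: leq_trans sl _; lia.
suff -> : x = y by [].
apply: contrapT => /(exists_side hX) [u [xu _]].
by rewrite sy //; apply/nl.
Qed.

(** Since medians are Lipschitz, each iteration stays at bounded distance from an
    approximate subalgebra. *)
Lemma generated_near D A C : degree_le D ->
    (forall x y z, A x -> A y -> A z -> exists2 a, A a & d (med x y z) a <= C) ->
  exists R, forall x, generated A x -> exists2 a, A a & d x a <= R.
Proof.
move=> deg approx.
suff H n : exists R, forall x, iterated_medians A n x -> exists2 a, A a & d x a <= R.
  by have [R HR] := H D; exists R => x /(generated_iterated_medians deg)/HR.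
elim: n => [|n [R HR]]; first by exists 0 => x Ax; exists x; rewrite ?vdist_refl.
exists (3 * R + C) => _ [x [y [z [/HR[x' Ax' xx'] /HR[y' Ay' yy'] /HR[z' Az' zz'] ->]]]].
have [a Aa ma] := approx _ _ _ Ax' Ay' Az'; exists a => //.
have := vdist_triangle hX (med x' y' z') (med x y z) a.
have := median_lipschitz hX x y z x' y' z'; lia.
Qed.

End Generated.

(** * Median subalgebras as discrete median algebras *)

Section Subalgebra.
Variable X : cube_complex.
Hypothesis hX : cat0 X.
Variable M : set X.
Hypothesis M_median : forall x y z, M x -> M y -> M z -> M (median x y z).

Local Notation d := (@vdist X).
Local Notation adj := (@adjacent X).

Definition subalgebra := {x : X | M x}.
Implicit Types v w t : subalgebra.

Definition sub_median v w t : subalgebra :=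
  exist _ _ (M_median (svalP v) (svalP w) (svalP t)).

Lemma sub_val_inj v w : sval v = sval w -> v = w.
Proof. by case: v w => [v Mv] [w Mw] /= e; apply: eq_exist. Qed.

Lemma sub_side_halfspace (x u : X) : adj x u -> halfspace sub_median (side x u \o sval).
Proof. by move=> xu v w t; apply: side_halfspace. Qed.

Lemma sub_separated : separated sub_median.
Proof.
move=> v w H; apply: sub_val_inj; apply: contrapT => /(exists_side hX) [u [xu s]].
by have := H _ (sub_side_halfspace xu); rewrite /= s => <-.
Qed.

Lemma sub_dist_between v t w : between sub_median v t w ->
  d (sval v) (sval w) = d (sval v) (sval t) + d (sval t) (sval w).
Proof.
move=> b; have e : sub_median v t w = t.
  apply: sub_separated => h hh; rewrite hh /majority.
  by have := b h hh; case: (h v); case: (h w); case: (h t) => //; move/(_ erefl).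
have [_ _ /(on_geodesicP hX)] := medianP hX (sval v) (sval t) (sval w).
by rewrite -[median _ _ _]/(sval (sub_median v t w)) e.
Qed.

Lemma sub_dist_eq0 v w : d (sval v) (sval w) = 0 -> v = w.
Proof. by move=> /(vdist_eq0 hX)/sub_val_inj. Qed.

(** The halfspace of [X] given by the edge from [v] to [u] separates [v] from both
    [w] and [w'], which [corner_disjoint] excludes if these are different. Hence
    the degree does not increase from [X] to a subalgebra. *)
Lemma sub_adjacent_uniq v w w' (u : X) : median_adjacent sub_median v w ->
    median_adjacent sub_median v w' -> adj (sval v) u ->
    ~~ side (sval v) u (sval w) -> ~~ side (sval v) u (sval w') ->
  w = w'.
Proof.
move=> vw vw' vu sw sw'; apply: contrapT => ne.
pose a (i : 'I_2) := if i == ord0 then w else w'.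
have a_inj : injective a.
  by move=> i j; case: (ord2P i) => ->; case: (ord2P j) => -> // e;
     case: ne; (exact: e || exact: esym e).
have adj_a i : median_adjacent sub_median v (a i) by rewrite /a; case: ifP.
have sv : side (sval v) u (sval v).
  by rewrite /side vdist_refl lt0n; apply/eqP => /(vdist_eq0 hX)/(adjacent_neq vu).
have := corner_disjoint sub_separated adj_a a_inj (i := ord0) (j := ord_max)
  (sub_side_halfspace vu).
by rewrite /= sv (negPf sw) (negPf sw') => /(_ isT isT).
Qed.

End Subalgebra.

Local Open Scope group_scope.

(** * Isomorphisms of median algebras *)

Section MedianIsomorphisms.
Variables (V : Type) (med : V -> V -> V -> V) (phi psi : V -> V).
Hypotheses (phi_med : forall x y z, phi (med x y z) = med (phi x) (phi y) (phi z))
           (psi_med : forall x y z, psi (med x y z) = med (psi x) (psi y) (psi z))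
           (phiK : cancel phi psi) (psiK : cancel psi phi).

Lemma halfspace_comp_phi h : halfspace med (h \o phi) <-> halfspace med h.
Proof.
split=> hh x y z; last by rewrite /= phi_med hh.
by rewrite -(psiK x) -(psiK y) -(psiK z) -phi_med; apply: hh.
Qed.

Lemma comp_psi_phi (h : V -> bool) : (h \o psi) \o phi = h.
Proof. by apply/funext => x; rewrite /= phiK. Qed.

Lemma median_cube_comp n (f : cube_vertex n -> V) :
  median_cube med f -> median_cube med (phi \o f).
Proof.
case=> D [D1 D2 D3 D4 D5]; exists (fun i h => D i (h \o phi)); split.
- by move=> i; have [h Dh] := D1 i; exists (h \o psi); rewrite comp_psi_phi.
- by move=> i h /D2 hh; apply/(halfspace_comp_phi h).
- move=> i h h' t t' Dh Dh'; have := D3 i _ _ (psi t) (psi t') Dh Dh'.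
  by rewrite /= !psiK.
- by move=> i h x Dh; apply: (D4 i _ x Dh).
- by move=> h x hh nD; apply: (D5 _ x ((halfspace_comp_phi h).2 hh) nD).
Qed.

Lemma between_phi x t y : between med x t y -> between med (phi x) (phi t) (phi y).
Proof. by move=> b h hh e; apply: (b _ ((halfspace_comp_phi h).2 hh)). Qed.

End MedianIsomorphisms.

Lemma median_adjacent_phi V (med : V -> V -> V -> V) (phi psi : V -> V) x y :
    (forall x y z, psi (med x y z) = med (psi x) (psi y) (psi z)) ->
    cancel phi psi -> cancel psi phi ->
  median_adjacent med x y -> median_adjacent med (phi x) (phi y).
Proof.
move=> psiM phiK psiK [ne b]; split=> [/(can_inj phiK) //|t bt].
have := between_phi psiM phiK bt; rewrite !phiK => /b.
by case=> <-; [left|right]; rewrite psiK.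
Qed.

(** * Finite sets *)

Lemma finite_set_list T (A : set T) : finite_set A <->
  exists l, forall x, A x <-> List.In x l.
Proof.
have inE (T' : eqType) (x : T') s : x \in s <-> List.In x s.
  elim: s => //= y s IH; rewrite inE; split.
    by case/orP => [/eqP ->|/IH]; [left|right].
  by case=> [->|/IH ->]; rewrite ?eqxx ?orbT.
split=> [fA|[l Al]].
  have /(@finite_seqP {classic T})[s sA] := fA.
  by exists s => x; rewrite sA /=; apply: (inE {classic T}).
apply/(@finite_seqP {classic T}); exists l; apply/seteqP.
by split=> x; [move/Al/(inE {classic T})|move/(inE {classic T})/Al].
Qed.

Lemma finite_set_bounded T (A : set T) (f : T -> nat) : finite_set A ->
  exists N, forall x, A x -> f x <= N.
Proof.
case/finite_set_list => l Al.
suff [N HN] : exists N, forall x, List.In x l -> f x <= N by exists N => x /Al /HN.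
elim: l {A Al} => [|x l [N HN]]; first by exists 0.
exists (maxn (f x) N) => y /= [<-|/HN]; first exact: leq_maxl.
by move=> fy; apply: leq_trans fy (leq_maxr _ _).
Qed.

(** * Cubical actions *)

Section CubicalActions.
Variables (H : groupType) (X : cube_complex) (hX : cat0 X) (b : cubical_action H X).
Implicit Types (g h : H) (x y z : X).

Local Notation d := (@vdist X).
Local Notation adj := (@adjacent X).

Lemma actK g : cancel (b g) (b g^-1).
Proof. by move=> x; rewrite -actM mulVg act1. Qed.

Lemma actVK g : cancel (b g^-1) (b g).
Proof. by move=> x; rewrite -actM mulgV act1. Qed.

Lemma act_adjacent g x y : adj x y -> adj (b g x) (b g y).
Proof.
case=> f [fc <- <-]; exists (b g \o f); split=> //; exact: act_cube.
Qed.

Lemma act_walk g n x y : walk adj n x y -> walk adj n (b g x) (b g y).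
Proof.
elim: n x => [x -> //|n IH x [z [xz zy]]]; exists (b g z); split; last exact: IH.
exact: act_adjacent.
Qed.

Lemma act_vdist g x y : d (b g x) (b g y) = d x y.
Proof.
have le k u v : d (b k u) (b k v) <= d u v.
  by apply: graph_dist_le; apply: act_walk; apply: dist_walk; apply: connected.
by apply/eqP; rewrite eqn_leq le /= -{1}(actK g x) -{1}(actK g y) le.
Qed.

Lemma act_median g x y z : b g (median x y z) = median (b g x) (b g y) (b g z).
Proof.
apply: median_uniq => //.
have [/(on_geodesicP hX) xy /(on_geodesicP hX) yz /(on_geodesicP hX) xz] := medianP hX x y z.
by split; apply/(on_geodesicP hX); rewrite !act_vdist.
Qed.

Lemma finite_ball D x r : degree_le X D -> finite_set [set y | d x y <= r].
Proof.
move=> deg; elim: r x => [|r IH] x.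
  apply: sub_finite_set (finite_set1 x) => y /=.
  by rewrite leqn0 => /eqP/(vdist_eq0 hX).
have fin : finite_set ([set x] `|` \bigcup_(z in [set z | adj x z]) [set y | d z y <= r]).
  rewrite finite_setU; split; first exact: finite_set1.
  apply: bigcup_finite => [|z _]; last exact: IH.
  by apply/finite_set_list; have [l _ xl] := deg x; exists l.
apply: sub_finite_set fin => y /= dxy.
have [->|/(exists_closer hX) [z xz e]] := pselect (x = y); first by left.
by right; exists z => //=; rewrite -ltnS -e.
Qed.

Lemma proper_stabilizer D p r : degree_le X D -> proper_action b ->
  finite_set [set h | d p (b h p) <= r].
Proof.
move=> deg prop; apply: sub_finite_set (prop _ (finite_ball p r deg)) => h /= dh.
by exists p => //=; rewrite vdist_refl.
Qed.

(** By cocompactness an edge at a vertex of [K] is moved into [K], and this by one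
    of finitely many elements, by properness. *)
Lemma cocompact_degree : proper_action b -> cocompact_action b -> exists D, degree_le X D.
Proof.
move=> prop [K finK cov].
have nbrs x : K x -> finite_set [set u | adj x u].
  move=> Kx; have fin := bigcup_finite (prop K finK) (fun g _ => finite_image (b g^-1) finK).
  apply: sub_finite_set fin => u /= [f [fc f0 f1]].
  have [g gf] := cov 1%N f fc; exists g => /=.
    by exists x => //; rewrite -f0; apply: gf.
  by exists (b g u); rewrite ?actK // -f1; apply: gf.
have [len lenP] : exists len : X -> nat, forall x, K x ->
    exists2 l, size l <= len x & forall u, adj x u <-> List.In u l.
  have /choice[len lenP] : forall x, exists n, K x ->
      exists2 l, size l <= n & forall u, adj x u <-> List.In u l.
    move=> x; have [Kx|nK] := pselect (K x); last by exists 0 => /nK.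
    by have /finite_set_list[l lP] := nbrs x Kx; exists (size l) => _; exists l.
  by exists len.
have [D DP] := finite_set_bounded len finK.
exists D => x; have [g gx] := cov 0%N _ (is_cube_vertex x).
have Kgx : K (b g x) := gx (origin 0).
have [l sl lP] := lenP _ Kgx; exists (map (b g^-1) l).
  by rewrite size_map; apply: leq_trans sl (DP _ Kgx).
move=> u; split=> [/(act_adjacent g)/lP gu|].
  by rewrite -[u](actK g); apply: List.in_map.
move=> /List.in_map_iff[v [<- /lP gv]].
by have := act_adjacent g^-1 gv; rewrite actK.
Qed.

End CubicalActions.

(** * Word metrics *)

Section WordMetrics.
Variable G : groupType.
Implicit Types (S : set G) (g h k : G).

Lemma cayley_sym S g h : cayley_edge S g h -> cayley_edge S h g.
Proof.
by case=> s Ss [->|->]; exists s => //; [right; rewrite mulgK|left; rewrite mulgVK].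
Qed.

Lemma cayley_mulg S k g h : cayley_edge S g h -> cayley_edge S (k * g) (k * h).
Proof. by case=> s Ss [->|->]; exists s => //; rewrite mulgA; [left|right]. Qed.

Lemma walk_mulg S k n g h : walk (cayley_edge S) n g h ->
  walk (cayley_edge S) n (k * g) (k * h).
Proof.
elim: n g => [g -> //|n IH g [z [gz zh]]]; exists (k * z).
by split; [apply: cayley_mulg|apply: IH].
Qed.

Lemma cayley_connected S : generates S ->
  forall g h, exists n, walk (cayley_edge S) n g h.
Proof.
move=> gen g h; have [n w] := gen (g^-1 * h); exists n.
by have := walk_mulg g w; rewrite mulg1 mulVKg.
Qed.

Lemma word_dist_walk S : generates S -> forall g h,
  walk (cayley_edge S) (word_dist S g h) g h.
Proof. by move=> gen; apply: dist_walk; apply: cayley_connected. Qed.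

Lemma word_dist_sym S : generates S -> forall g h, word_dist S g h = word_dist S h g.
Proof. by move=> gen; apply: dist_sym (cayley_connected gen) (@cayley_sym S). Qed.

Lemma word_dist_triangle S : generates S -> forall g h k,
  word_dist S g k <= word_dist S g h + word_dist S h k.
Proof. by move=> gen g h k; apply: dist_triangle; apply: cayley_connected. Qed.

Lemma word_dist_mulg S k g h : generates S ->
  word_dist S (k * g) (k * h) = word_dist S g h.
Proof.
move=> gen; have le k' u v : word_dist S (k' * u) (k' * v) <= word_dist S u v.
  by apply: graph_dist_le; apply: walk_mulg; apply: word_dist_walk.
by apply/eqP; rewrite eqn_leq le /= -{1}(mulKg k g) -{1}(mulKg k h) le.
Qed.

Lemma finite_word_ball S n : finite_set S -> generates S ->
  finite_set [set g | word_dist S 1 g <= n].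
Proof.
move=> finS gen.
have fin m : finite_set [set g | walk (cayley_edge S) m 1 g].
  elim: m => [|m IH].
    by apply: sub_finite_set (finite_set1 1) => g /= <-.
  have finS2 : finite_set ((fun s => s) @` S `|` (fun s => s^-1) @` S).
    by rewrite finite_setU; split; apply: finite_image.
  have := bigcup_finite finS2 (fun t _ => finite_image (fun g => t * g) IH).
  apply: sub_finite_set => g /= [z [[s Ss e] zg]].
  exists z; first by case: e => ->; rewrite mul1g; [left|right]; exists s.
  exists (z^-1 * g); last by rewrite mulVKg.
  by have := walk_mulg z^-1 zg; rewrite mulVg.
have := bigcup_finite (finite_II n.+1) (fun m _ => fin m).
apply: sub_finite_set => g /= gn; exists (word_dist S 1 g) => //=.
exact: word_dist_walk.
Qed.

(** This compares word metrics with each other, and with the metric of an orbit of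
    vertices. *)
Lemma word_lipschitz S (delta : G -> G -> nat) : finite_set S ->
    (forall g, delta g g = 0) -> (forall g h, delta g h = delta h g) ->
    (forall g h k, delta g k <= delta g h + delta h k) ->
    (forall g h k, delta (k * g) (k * h) = delta g h) ->
  exists L, forall n g h, walk (cayley_edge S) n g h -> delta g h <= L * n.
Proof.
move=> finS d0 dsym dtri dmul.
have [L HL] := finite_set_bounded (delta 1) finS.
exists L; elim=> [|n IH] g h /=; first by move=> ->; rewrite d0.
case=> z [[s Ss e] /IH zh].
apply: leq_trans (dtri g z h) _; rewrite mulnS leq_add //.
case: e => ->; first by rewrite -{1}(mulg1 g) dmul; apply: HL.
by rewrite dsym -{2}(mulgVK s g) -{1}(mulg1 (g * s^-1)) dmul; apply: HL.
Qed.

End WordMetrics.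

(** * Groups with an approximate median orbit *)

Section ApproximateOrbit.
Variables (H : groupType) (X : cube_complex) (hX : cat0 X) (b : cubical_action H X).
Variables (D C : nat) (p : X).
Hypotheses (deg : degree_le X D) (proper : proper_action b).
Hypothesis approx : forall h1 h2 h3, exists h,
  vdist (median (b h1 p) (b h2 p) (b h3 p)) (b h p) <= C.
Implicit Types (g h : H).

Local Notation d := (@vdist X).
Local Notation adj := (@adjacent X).

Definition orbit : set X := [set x | exists h, x = b h p].

(** The median subalgebra generated by the orbit; its distance from the orbit is
    bounded by [hull_near]. *)
Definition hull : set X := generated orbit.

Lemma hull_median x y z : hull x -> hull y -> hull z -> hull (median x y z).
Proof. exact: generated_median. Qed.

Lemma hull_act h x : hull x -> hull (b h x).
Proof.
elim=> [_ [g ->]|x1 x2 x3 _ h1 _ h2 _ h3].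
  by apply: generated_in; exists (h * g); rewrite actM.
by rewrite (act_median hX); apply: generated_median.
Qed.

Lemma hull_near : exists R, forall x, hull x -> exists h, d (b h p) x <= R.
Proof.
have [|R HR] := generated_near hX (A := orbit) (C := C) deg.
  move=> _ _ _ [h1 ->] [h2 ->] [h3 ->]; have [h hC] := approx h1 h2 h3.
  by exists (b h p) => //; exists h.
exists R => x /HR[_ [h ->] xh]; exists h; by rewrite vdist_sym.
Qed.

Notation hullT := (subalgebra hull).
Notation medT := (sub_median hull_median).
Notation sepT := (@sub_separated X hX hull hull_median).
Notation adjT := (median_adjacent medT).

Definition hull_action_fun h (v : hullT) : hullT :=
  exist _ (b h (sval v)) (hull_act h (svalP v)).

Lemma hull_action1 v : hull_action_fun 1 v = v.
Proof. by apply: sub_val_inj; rewrite /= act1. Qed.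

Lemma hull_actionM g h v :
  hull_action_fun (g * h) v = hull_action_fun g (hull_action_fun h v).
Proof. by apply: sub_val_inj; rewrite /= actM. Qed.

Lemma hull_action_median h v w t :
  hull_action_fun h (medT v w t) =
  medT (hull_action_fun h v) (hull_action_fun h w) (hull_action_fun h t).
Proof. by apply: sub_val_inj; rewrite /= (act_median hX). Qed.

Lemma hull_actionK h : cancel (hull_action_fun h) (hull_action_fun h^-1).
Proof. by move=> v; apply: sub_val_inj; rewrite /= actK. Qed.

Lemma hull_actionVK h : cancel (hull_action_fun h^-1) (hull_action_fun h).
Proof. by move=> v; apply: sub_val_inj; rewrite /= actVK. Qed.

Lemma hull_action_adjacent h v w : adjT v w ->
  adjT (hull_action_fun h v) (hull_action_fun h w).
Proof.
apply: median_adjacent_phi (hull_actionK h) (hull_actionVK h).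
exact: hull_action_median.
Qed.

Definition hull_complex : cube_complex := median_complex sepT.

Lemma hull_action_cube h n (f : cube_vertex n -> hull_complex) :
  is_cube f -> is_cube ((hull_action_fun h : hull_complex -> hull_complex) \o f).
Proof.
exact: (@median_cube_comp hullT medT _ _ (hull_action_median h) (hull_actionK h)
  (hull_actionVK h)).
Qed.

Definition hull_action : cubical_action H hull_complex :=
  @CubicalAction H hull_complex hull_action_fun hull_action1 hull_actionM hull_action_cube.

Lemma hull_cat0 : cat0 hull_complex.
Proof.
apply: (@median_complex_cat0 _ _ (fun v w => d (sval v) (sval w))).
- exact: sub_dist_between.
- exact: sub_dist_eq0.
- have pM : hull p by apply: generated_in; exists 1; rewrite act1.
  by exists (exist _ p pM).
Qed.

Lemma hull_proper : proper_action hull_action.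
Proof.
move=> K finK; apply: sub_finite_set (proper (finite_image sval finK)) => h /= [v Kv Khv].
by exists (sval v); [exists v|exists (hull_action_fun h v)].
Qed.

(** An edge at [v] is determined by the first edge of [X] on a geodesic between
    its ends, so that there are finitely many edges near [p]. *)
Lemma hull_edge_bounded : exists L, forall v w : hullT, adjT v w -> d (sval v) (sval w) <= L.
Proof.
have [R HR] := hull_near.
pose E (yu : X * X) := [set x : X | exists v w : hullT, [/\ sval v = yu.1, sval w = x,
  adjT v w, adj yu.1 yu.2 & ~~ side yu.1 yu.2 x]].
have finE : finite_set (\bigcup_(y in [set y | d p y <= R])
    \bigcup_(u in [set u | adj y u]) E (y, u)).
  apply: bigcup_finite; first exact: (finite_ball hX p R deg).
  move=> y _; apply: bigcup_finite.
    by apply/finite_set_list; have [l _ lP] := deg y; exists l.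
  move=> u _; have [[x0 E0]|nE] := pselect (exists x, E (y, u) x); last first.
    by apply: sub_finite_set (finite_set0 _) => x Ex; case: nE; exists x.
  apply: sub_finite_set (finite_set1 x0) => x.
  case: E0 => v [w [/= vy wx vw yu su]] [v' [w' [/= v'y wx' vw' _ su']]].
  have e : v' = v by apply: sub_val_inj; rewrite vy v'y.
  rewrite e in vw'; rewrite -wx -wx'; congr sval.
  by apply: (sub_adjacent_uniq hX vw' vw (u := u)); rewrite vy ?wx ?wx'.
have [L HL] := finite_set_bounded (d p) finE.
exists (R + L) => v w vw; have [h hR] := HR _ (svalP v).
have vw' := hull_action_adjacent h^-1 vw.
have dv : d p (b h^-1 (sval v)) <= R by rewrite -(act_vdist hX b h) actVK.
rewrite -(act_vdist hX b h^-1).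
apply: leq_trans (vdist_triangle hX p _ _) _; rewrite (vdist_sym hX _ p).
apply: leq_add => //; apply: HL; exists (b h^-1 (sval v)) => //=.
have [|u [yu _ su]] := exists_side hX (x := b h^-1 (sval v)) (y := b h^-1 (sval w)).
  by move=> e; case: vw' => + _; apply; apply: sub_val_inj.
exists u => //; exists (hull_action_fun h^-1 v), (hull_action_fun h^-1 w).
by split.
Qed.

(** The first edges of [X] towards the neighbours of [v] in a cube are distinct. *)
Lemma hull_cube_dim n (f : cube_vertex n -> hull_complex) : is_cube f -> n <= D.
Proof.
case=> E fE; set v := f (origin n).
have [l sl lP] := deg (sval v).
have adj_f i : adjT v (f (unit_vertex i)) := bundle_adjacent sepT fE i.
have /choice[k kP] : forall i : 'I_n, exists k : 'I_(size l),
    adj (sval v) (tnth (in_tuple l) k) /\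
    ~~ side (sval v) (tnth (in_tuple l) k) (sval (f (unit_vertex i))).
  move=> i; have [|u [vu _ su]] := exists_side hX (x := sval v) (y := sval (f (unit_vertex i))).
    by move=> e; case: (adj_f i) => + _; apply; apply: sub_val_inj.
  have [m [ml lm]] := List.In_nth l u (sval v) ((lP u).1 vu).
  have {}ml : m < size l by apply/ltP.
  have lmu : tnth (in_tuple l) (Ordinal ml) = u.
    rewrite (tnth_nth (sval v)) /= -lm.
    by elim: (l) (m) => [|y l' IH] [|m'] //=.
  by exists (Ordinal ml); rewrite lmu.
have k_inj : injective k.
  move=> i j kij; have [vu su] := kP i; have [_] := kP j; rewrite -kij => su'.
  have := sub_adjacent_uniq hX (adj_f i) (adj_f j) vu su su'.
  move=> /(median_cube_inj fE)/ffunP/(_ i); rewrite !ffunE eqxx => /esym/eqP; by [].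
by have := leq_card k k_inj; rewrite !card_ord => /leq_trans; apply.
Qed.

Lemma hull_cube_diam L n (f : cube_vertex n -> hull_complex) x :
    (forall v w : hullT, adjT v w -> d (sval v) (sval w) <= L) ->
  is_cube f -> d (sval (f (origin n))) (sval (f x)) <= n * L.
Proof.
move=> HL fc; pose y k : cube_vertex n := [ffun i : 'I_n => (i < k) && x i].
have -> : x = y n by apply/ffunP => i; rewrite ffunE ltn_ord.
suff near k : k <= n -> d (sval (f (origin n))) (sval (f (y k))) <= k * L by apply: near.
elim: k => [_|k IH kn].
  rewrite (_ : y 0%N = origin n) ?vdist_refl //.
have := IH (ltnW kn); pose i0 := Ordinal kn.
have yS i : i != i0 -> y k.+1 i = y k i.
  by move=> ne; rewrite !ffunE ltnS leq_eqVlt (_ : (i == k :> nat) = false) //; apply: negPf.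
have yk0 : y k i0 = false by rewrite ffunE ltnn.
have yS0 : y k.+1 i0 = x i0 by rewrite ffunE ltnSn.
case xk : (x i0).
  have -> : y k.+1 = flip (y k) i0.
    apply/ffunP => i; rewrite [RHS]ffunE; have [->|ne] := eqVneq i i0.
      by rewrite yk0 yS0 xk.
    by rewrite yS // addbF.
  move=> le; apply: leq_trans (vdist_triangle hX (sval (f (y k))) _ _) _.
  rewrite mulSn addnC leq_add // HL //.
  by apply/(adjacentE sepT); apply: cube_edge.
have -> : y k.+1 = y k.
  apply/ffunP => i; have [->|ne] := eqVneq i i0; first by rewrite yk0 yS0 xk.
  exact: yS.
by move=> le; apply: leq_trans le _; rewrite leq_mul2r leqnSn orbT.
Qed.

(** A cube is moved so that one of its vertices is near [p]; it then lies in a ball,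
    which is finite, since its dimension and its edges are bounded. *)
Lemma hull_cocompact : cocompact_action hull_action.
Proof.
have [R HR] := hull_near; have [L HL] := hull_edge_bounded.
exists [set v : hull_complex | d p (sval v) <= R + D * L].
  have fin := finite_ball hX p (R + D * L) deg.
  apply: (finite_preimage _ fin) => v w _ _; exact: sub_val_inj.
move=> n f fc; have [h hR] := HR _ (svalP (f (origin n))).
exists h^-1 => x /=; rewrite -(act_vdist hX b h) actVK.
apply: leq_trans (vdist_triangle hX (sval (f (origin n))) _ _) _; apply: leq_add => //.
apply: leq_trans (hull_cube_diam x HL fc) _.
by rewrite leq_mul2r (hull_cube_dim fc) orbT.
Qed.

(** As the edges of the hull are bounded in [X], following one from near an orbit
    point [b g p] takes a generator from a finite set; and geodesics between points of
    the hull have no more edges there than in [X]. *)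
Lemma orbit_generating : exists T : set H,
  finite_generating T /\ forall h, word_dist T 1 h <= (d p (b h p)).+1.
Proof.
have [R HR] := hull_near; have [L HL] := hull_edge_bounded.
pose T : set H := [set h | d p (b h p) <= R + L + R].
have stepT g h : d (b g p) (b h p) <= R + L + R -> cayley_edge T g h.
  move=> gh; exists (g^-1 * h); last by left; rewrite mulVKg.
  by rewrite /T /= -(act_vdist hX b g) -actM mulVKg.
have path h (v : hullT) g : d (b g p) (sval v) <= R -> exists2 m, m <= (d (sval v) (b h p)).+1 &
    walk (cayley_edge T) m g h.
  have Mh : hull (b h p) by apply: generated_in; exists h.
  pose w : hullT := exist _ _ Mh.
  have [n] := ubnP (d (sval v) (sval w)); elim: n v g => // n IH v g /ltnSE dn gv.
  have [e|ne] := pselect (v = w).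
    exists 1%N => //; apply: walk1; apply: stepT.
    by move: gv; rewrite e /= => gv; lia.
  have [z vz bz] := exists_adjacent (@sub_dist_between X hX _ hull_median)
    (fun v w => @sub_dist_eq0 X hX _ v w) ne.
  have e := sub_dist_between hX bz.
  have dvz : 0 < d (sval v) (sval z).
    by rewrite lt0n; apply/eqP => /(sub_dist_eq0 hX) vz0; case: vz => + _; rewrite vz0.
  have [g1 g1z] := HR _ (svalP z).
  have [|m mz wm] := IH z g1 _ g1z; first lia.
  exists m.+1; first by move: mz; rewrite -[b h p]/(sval w); lia.
  exists g1; split=> //; apply: stepT.
  have := HL _ _ vz; have := vdist_triangle hX (sval v) (b g p) (b g1 p).
  have := vdist_triangle hX (sval z) (sval v) (b g1 p); rewrite (vdist_sym hX (sval z) (b g1 p)).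
  lia.
have path1 h : exists2 m, m <= (d p (b h p)).+1 & walk (cayley_edge T) m 1 h.
  have Mp : hull p by apply: generated_in; exists 1; rewrite act1.
  by apply: (path h (exist _ _ Mp : hullT) 1); rewrite act1 vdist_refl.
exists T; split; last first.
  by move=> h; have [m mh w] := path1 h; apply: leq_trans mh; apply: graph_dist_le.
split; first exact: (proper_stabilizer hX p _ deg proper).
by move=> h; have [m _ w] := path1 h; exists m.
Qed.

End ApproximateOrbit.

(** * Fixed subgroups *)

Section FixedSubgroups.
Variables (G : groupType) (phi : {multiplicative G -> G}).

Lemma fixed_eq (h : Fix phi) : phi (fix_val h) = fix_val h.
Proof. exact: eqP (fix_valP h). Qed.

Lemma fix_val_inj : injective (@fix_val G phi).
Proof. exact: val_inj. Qed.

Variables (X : cube_complex) (a : cubical_action G X).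

Definition fix_action : cubical_action (Fix phi) X :=
  @CubicalAction (Fix phi) X (fun h => a (fix_val h)) (act1 a)
    (fun g h => actM a (fix_val g) (fix_val h)) (fun h => @act_cube G X a (fix_val h)).

Lemma fix_proper : proper_action a -> proper_action fix_action.
Proof.
move=> prop K finK; apply: (finite_preimage _ (prop K finK)) => g h _ _.
exact: fix_val_inj.
Qed.

(** If [w] and [m] are moved by [phi] by the same element, then [m * w^-1] is
    fixed; so one [w] for each element of the finite set [E] suffices. *)
Lemma almost_fixed_near (E : set G) (x : X) : cat0 X -> finite_set E ->
  exists N, forall m, E (m^-1 * phi m) ->
    exists h : Fix phi, vdist (a m x) (a (fix_val h) x) <= N.
Proof.
move=> hX finE.
have /choice[w wP] : forall e, exists w, (exists m, m^-1 * phi m = e) -> w^-1 * phi w = e.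
  move=> e; have [[m me]|no] := pselect (exists m, m^-1 * phi m = e); first by exists m.
  by exists 1.
have [N HN] := finite_set_bounded (fun e => vdist (a (w e) x) x) finE.
exists N => m Em; set e := m^-1 * phi m in Em.
have we := wP e (ex_intro _ m erefl).
have fixed : fixed_pred phi (m * (w e)^-1).
  apply/eqP; apply: (mulIg (phi (w e))).
  by rewrite -gmulfM mulgVK -mulgA we mulVKg.
exists (MkFix fixed) => /=.
by rewrite -{1}(mulgVK (w e) m) actM (act_vdist hX); apply: HN.
Qed.

(** For fixed [g1], [g2], [g3], the coarse median [mu g1 g2 g3] is moved by [phi] by
    a bounded amount. *)
Lemma fix_orbit_approximate (p : X) (mu : G -> G -> G -> G) (S : set G) : cat0 X ->
    represents_coarse_median a p mu -> finite_generating S ->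
    coarse_median_preserving mu S phi ->
  exists C, forall h1 h2 h3 : Fix phi, exists h : Fix phi,
    vdist (median (fix_action h1 p) (fix_action h2 p) (fix_action h3 p)) (fix_action h p)
      <= C.
Proof.
move=> hX [C1 HC1] [finS genS] [C2 HC2].
have [N HN] := almost_fixed_near p hX (finite_word_ball C2 finS genS).
exists (C1 + N) => h1 h2 h3; set m := mu (fix_val h1) (fix_val h2) (fix_val h3).
have [h Hh] : exists h : Fix phi, vdist (a m p) (a (fix_val h) p) <= N.
  apply: HN => /=; have := HC2 (fix_val h1) (fix_val h2) (fix_val h3).
  by rewrite !fixed_eq -/m (word_dist_sym genS) -(word_dist_mulg m^-1) // mulVg.
exists h; apply: leq_trans (vdist_triangle hX (a m p) _ _) _.
by apply: leq_add => //; rewrite (vdist_sym hX); exact: HC1.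
Qed.

(** The orbit map of [G] is Lipschitz, and so is that of a generating set into any
    other one. *)
Lemma fix_undistorted (p : X) (T0 : set (Fix phi)) : cat0 X -> finite_generating T0 ->
    (forall h, word_dist T0 1 h <= (vdist p (fix_action h p)).+1) ->
  undistorted (@fix_val G phi).
Proof.
move=> hX [finT0 genT0] HT0 T S [finT genT] [finS genS].
have [L1 HL1] := word_lipschitz
  (delta := fun g h : Fix phi => word_dist S (fix_val g) (fix_val h)) finT
  (fun g => dist_refl _ _) (fun g h => word_dist_sym genS _ _)
  (fun g h k => word_dist_triangle genS _ _ _) (fun g h k => word_dist_mulg _ _ _ genS).
have [L2 HL2] := word_lipschitz (delta := word_dist T) finT0
  (fun g => dist_refl _ _) (word_dist_sym genT) (word_dist_triangle genT)
  (fun g h k => word_dist_mulg k g h genT).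
have [L3 HL3] := word_lipschitz (delta := fun g h => vdist (a g p) (a h p)) finS
  (fun g => vdist_refl _) (fun g h => vdist_sym hX _ _)
  (fun g h k => vdist_triangle hX _ _ _)
  (fun g h k => etrans (congr2 (@vdist X) (actM a k g p) (actM a k h p))
                       (act_vdist hX a k _ _)).
exists (L1 + L2 * L3), L2 => x y; split.
  have := HL1 _ _ _ (word_dist_walk genT x y); nia.
have le2 := HL2 _ _ _ (word_dist_walk genT0 x y).
have le3 := HL3 _ _ _ (word_dist_walk genS (fix_val x) (fix_val y)).
have le0 : word_dist T0 x y <= (vdist (a (fix_val x) p) (a (fix_val y) p)).+1.
  rewrite -(word_dist_mulg x^-1) // mulVg; apply: leq_trans (HT0 _) _.
  by rewrite -(act_vdist hX fix_action x) -actM mulVKg.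
nia.
Qed.

End FixedSubgroups.

Theorem theorem2 (G : groupType) (X : cube_complex) (hX : cat0 X)
    (a : cubical_action G X) (ha_proper : proper_action a)
    (ha_cocompact : cocompact_action a)
    (p : X) (mu : G -> G -> G -> G) (hmu : represents_coarse_median a p mu)
    (S : set G) (hS : finite_generating S)
    (phi : {multiplicative G -> G}) (hphi_bij : bijective phi)
    (hphi : coarse_median_preserving mu S phi) :
  (finitely_generated (Fix phi) /\ undistorted (@fix_val G phi)) /\
  (exists (Y : cube_complex) (b : cubical_action (Fix phi) Y),
     [/\ cat0 Y, proper_action b & cocompact_action b]).
Proof.
have [D deg] := cocompact_degree ha_proper ha_cocompact.
have [C approx] := fix_orbit_approximate hX hmu hS hphi.
have prop := fix_proper phi ha_proper.
have [T0 [genT0 HT0]] := orbit_generating hX deg prop approx.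
split; first by split; [exists T0 | exact: (fix_undistorted hX genT0 HT0)].
exists (hull_complex hX (fix_action phi a) p), (hull_action hX (fix_action phi a) p).
by split; [exact: hull_cat0 | exact: hull_proper | exact: hull_cocompact approx].
Qed.
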